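(* Let $p\ge0$ be an integer and consider an arbitrary ESFR scheme of degree $p$ with parameter $c\in\mathbb{R}$ satisfying $c_-<c<\infty$. Then there exist constants $C_1,C_2>0$ (dependent on $c$) such that for all $\theta\in\mathbb{R}$ sufficiently small $$C_1F(p,c,\theta)\le E_T(\theta)\le C_2F(p,c,\theta),$$ where $$F(p,c,\theta):=\left|b_1(p,c)(i\theta)^{2p+1}+b_2(p,c)(i\theta)^{2p+2}\right|,$$ $$b_1(p,c):=\frac{(1-f(c))\,p!}{(2p)!},\qquad b_2(p,c):=\frac{(f(c)-1)\,p!}{2(2p)!}+\frac{(p+1)!}{(2p+2)!},\qquad f(c):=\frac{1}{1+c\,\frac{(2p+1)((2p)!)^2}{2^{2p+1}(p!)^2}}.$$
   Context: Let $\chi_0,\dots,\chi_p$ be a basis (with real coefficients) of the space $\mathcal P^p([-1,1])$ of polynomials of degree at most $p$. Define column vectors $(\mathbf l)_j=\chi_j(-1)$, $(\mathbf r)_j=\chi_j(1)$. $\mathbf D$ is the matrix of $d/d\xi$ on $\mathcal P^p([-1,1])$ in this basis, acting on coefficient vectors; $\mathbf M_{mn}=\int_{-1}^1\chi_m\chi_n\,d\xi$; $\mathbf K=\tfrac12c\,(\mathbf D^p)^T\mathbf M\mathbf D^p$, where $c\in\mathbb{R}$ is the ESFR scalar parameter. The threshold is $c_-=-\dfrac{2^{2p+1}(p!)^2}{(2p+1)((2p)!)^2}$ (so $\mathbf M+\mathbf K$ is positive definite if and only if $c>c_-$). The von Neumann matrix of the ESFR scheme (energy stable flux reconstruction scheme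 with upwind numerical flux for the linear advection equation $u_t+u_x=0$) is $$\mathbf H(\theta)=-2i\left(\mathbf D+(\mathbf M+\mathbf K)^{-1}\mathbf l\mathbf l^T-(\mathbf M+\mathbf K)^{-1}\mathbf l\mathbf r^Te^{-i\theta}\right),\qquad\theta\in\mathbb{R},\ i=\sqrt{-1}.$$ The physical eigenvalue $\omega^h(\theta)$ is the unique eigenvalue of $\mathbf H(\theta)$ that approximates the exact relation $\omega_{PDE}(\theta)=\theta$ as $\theta\to0$; i.e. for $\theta$ near $0$, $\omega^h$ is the unique continuous branch of eigenvalues of $\mathbf H(\theta)$ with $\omega^h(0)=0$. The dispersion-dissipation error is $E_T(\theta)=|\omega^h(\theta)-\theta|$. *)

(* Defs.v *)
From HB Require Import structures.
From mathcomp Require Import all_boot all_order all_algebra.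
From mathcomp Require Import all_classical all_reals all_analysis.
From mathcomp Require Import complex.

Set Implicit Arguments.
Unset Strict Implicit.
Unset Printing Implicit Defensive.

Import Order.TTheory GRing.Theory Num.Theory.
Import numFieldNormedType.Exports.
Local Open Scope classical_set_scope.
Local Open Scope ring_scope.
Local Open Scope complex_scope.

Section ESFR.
Context {R : realType} (p : nat).
Implicit Types (chi : (p.+1).-tuple {poly_p.+1 R}) (c theta : R).

(* {poly_p.+1 R} is the space of polynomials of degree at most p; the truncation
   performed by npolyp is void here, since derivation lowers the degree. *)
Definition npoly_deriv (q : {poly_p.+1 R}) : {poly_p.+1 R} :=
  npolyp p.+1 (val q)^`().

(* Columns are the images of the basis vectors, so D acts on column vectors of
   coefficients. *)
Definition diff_mx chi : 'M[R]_p.+1 :=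
  \matrix_(i, j) coord chi i (npoly_deriv (tnth chi j)).

Definition left_col chi : 'cV[R]_p.+1 := \col_j (val (tnth chi j)).[-1].

Definition right_col chi : 'cV[R]_p.+1 := \col_j (val (tnth chi j)).[1].

Definition mass_mx chi : 'M[R]_p.+1 :=
  \matrix_(m, n) \int[lebesgue_measure]_(xi in `[(-1 : R), 1])
    ((val (tnth chi m)).[xi] * (val (tnth chi n)).[xi]).

Definition corr_mx c chi : 'M[R]_p.+1 :=
  (2^-1 * c) *: ((diff_mx chi ^+ p)^T *m mass_mx chi *m (diff_mx chi ^+ p)).

Definition c_minus : R :=
  - ((2 ^+ (2 * p).+1 * (p`!%:R) ^+ 2) /
     ((2 * p).+1%:R * ((2 * p)`!%:R) ^+ 2)).

(* exp (i x) *)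
Definition expi (x : R) : R[i] := cos x +i* sin x.

Definition von_neumann_mx c chi theta : 'M[R[i]]_p.+1 :=
  let D := diff_mx chi in
  let l := left_col chi in
  let r := right_col chi in
  let MKinv := invmx (mass_mx chi + corr_mx c chi) in
  (- (2 * 'i%C)) *:
    (map_mx (real_complex R) D
     + map_mx (real_complex R) (MKinv *m l *m l^T)
     - expi (- theta) *: map_mx (real_complex R) (MKinv *m l *m r^T)).

(* A germ at theta = 0 of a continuous branch of eigenvalues through 0; the
   values of w away from 0 are irrelevant.  The codomain R[i]^o carries the
   topology of the complex modulus.  The library predicate eigenvalue is phrased
   with row eigenvectors, which yields the same spectrum as column ones. *)
Definition eigen_branch c chi (w : R -> R[i]^o) : Prop :=
  w 0 = 0 /\
  \forall theta \near (0 : R),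
    {for theta, continuous w} /\ eigenvalue (von_neumann_mx c chi theta) (w theta).

(* Uniqueness is uniqueness of germs at theta = 0. *)
Definition physical_eigenvalue c chi (w : R -> R[i]^o) : Prop :=
  eigen_branch c chi w /\
  forall w' : R -> R[i]^o, eigen_branch c chi w' ->
    \forall theta \near (0 : R), w' theta = w theta.

Definition E_T (w : R -> R[i]^o) theta : R :=
  ComplexField.Normc.normc (w theta - theta%:C).

Definition f_esfr c : R :=
  (1 + c * ((2 * p).+1%:R * ((2 * p)`!%:R) ^+ 2 /
            (2 ^+ (2 * p).+1 * (p`!%:R) ^+ 2)))^-1.

Definition b1 c : R := (1 - f_esfr c) * p`!%:R / (2 * p)`!%:R.

Definition b2 c : R :=
  (f_esfr c - 1) * p`!%:R / (2 * (2 * p)`!%:R) + p.+1`!%:R / (2 * p).+2`!%:R.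

Definition F_esfr c theta : R :=
  ComplexField.Normc.normc ((b1 c)%:C * ('i%C * theta%:C) ^+ (2 * p).+1 +
         (b2 c)%:C * ('i%C * theta%:C) ^+ (2 * p).+2).

End ESFR.

Arguments c_minus R p : clear implicits.
Arguments F_esfr {R} p c theta.

(* Main.v *)
Require Import Defs.
From HB Require Import structures.
From mathcomp Require Import all_boot all_order all_algebra.
From mathcomp Require Import all_classical all_reals all_analysis.
From mathcomp Require Import complex ring lra zify.
Import Order.TTheory GRing.Theory Num.Theory.
Import numFieldNormedType.Exports.
Local Open Scope classical_set_scope.
Local Open Scope ring_scope.

(* Write L for the polynomial of degree at most p representing (M + K)^-1 l, I for
   the integral over [-1, 1] and mu = i omega / 2.  Solving (mu - D) u = L by the
   finite Neumann series of the nilpotent D turns the eigenvalue problem into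
     mu^(p+1) - Q(mu) + e^(-i theta) P(mu) = 0,
   P, Q(mu) = sum_k L^(k)(+-1) mu^(p-k).  Inserting the exact value
   mu = i theta / 2 leaves P(mu) - e^(2 mu) (Q(mu) - mu^(p+1)); integrating
   (T sum_k mu^(p-k) L^(k))' for T the Taylor polynomial of e^(-mu (x - 1)) shows
   that its expansion is mu^(p+1) sum_j (-mu)^j / j! d_j, where
   d_j = (-2)^j - I(L (x - 1)^j).  As L represents evaluation at -1 for the form
   I(u v) + c u^(p) v^(p), the first non-zero d_j has index p if c <> 0 and p + 1
   if c = 0, which is also how the order of F depends on c.  Finally, mu = 0 is a
   simple root at theta = 0, so near 0 the characteristic polynomial is
   bi-Lipschitz in mu: this gives existence, uniqueness and continuity of the
   branch and compares |omega - theta| with the residual. *)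

Set Implicit Arguments.
Unset Strict Implicit.
Unset Printing Implicit Defensive.

(** * Integrals of polynomials over [-1, 1] *)

Section PolynomialIntegral.
Variable F : numFieldType.
Implicit Types (p q u f : {poly F}) (x a : F).

(** At i = 0 the convention [0^-1 = 0] makes the constant coefficient vanish. Being purely
    algebraic, this antiderivative is available over R[i] too, where the residual is computed. *)
Definition primp q : {poly F} := \poly_(i < (size q).+1) (q`_i.-1 / i%:R).

Definition intp q : F := (primp q).[1] - (primp q).[-1].

Lemma coef_primp q i : (primp q)`_i = q`_i.-1 / i%:R.
Proof.
rewrite coef_poly; case: ltnP => // lt_qi.
by case: i lt_qi => // i lt_qi; rewrite nth_default ?mul0r //=.
Qed.

Lemma deriv_primp q : (primp q)^`() = q.
Proof.
apply/polyP => i.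
by rewrite coef_deriv coef_primp -(mulr_natr (_ / _)) divfK ?pnatr_eq0.
Qed.

Lemma primpD p q : primp (p + q) = primp p + primp q.
Proof. by apply/polyP => i; rewrite coefD !coef_primp coefD mulrDl. Qed.

Lemma primpZ a q : primp (a *: q) = a *: primp q.
Proof. by apply/polyP => i; rewrite coefZ !coef_primp coefZ mulrA. Qed.

Lemma primp_deriv q : primp q^`() = q - (q`_0)%:P.
Proof.
apply/polyP => -[|i]; rewrite coefB coefC coef_primp /=.
  by rewrite invr0 mulr0 subrr.
by rewrite subr0 coef_deriv -(mulr_natr q`_i.+1) mulfK // pnatr_eq0.
Qed.

Lemma intp_deriv q : intp q^`() = q.[1] - q.[-1].
Proof. by rewrite /intp primp_deriv !(hornerD, hornerN,
  hornerC) opprB addrA subrK. Qed.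

Lemma intpD p q : intp (p + q) = intp p + intp q.
Proof. by rewrite /intp primpD !hornerD opprD addrACA. Qed.

Lemma intpZ a q : intp (a *: q) = a * intp q.
Proof. by rewrite /intp primpZ !hornerZ mulrBr. Qed.

Lemma intpZl a p q : intp ((a *: p) * q) = a * intp (p * q).
Proof. by rewrite -mul_polyC -mulrA mul_polyC intpZ. Qed.

Lemma intpZr a p q : intp (p * (a *: q)) = a * intp (p * q).
Proof. by rewrite [p * _]mulrC intpZl [q * p]mulrC. Qed.

Lemma intp0 : intp 0 = 0.
Proof. by rewrite -(scale0r 0) intpZ mul0r. Qed.

Lemma intpN q : intp (- q) = - intp q.
Proof. by rewrite -scaleN1r intpZ mulN1r. Qed.

Lemma intpB p q : intp (p - q) = intp p - intp q.
Proof. by rewrite intpD intpN. Qed.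

Lemma intpBl p q u : intp ((p - q) * u) = intp (p * u) - intp (q * u).
Proof. by rewrite mulrBl; exact: intpB. Qed.

Lemma intpBr p q u : intp (u * (p - q)) = intp (u * p) - intp (u * q).
Proof. by rewrite mulrBr; exact: intpB. Qed.

Lemma intp_sum (I : Type) (r : seq I) (P : pred I) (E : I -> {poly F}) :
  intp (\sum_(i <- r | P i) E i) = \sum_(i <- r | P i) intp (E i).
Proof. exact: (big_morph intp intpD intp0). Qed.

Lemma intp_parts u f :
  intp (u * f^`()) = u.[1] * f.[1] - u.[-1] * f.[-1] - intp (u^`() * f).
Proof.
have := intp_deriv (u * f); rewrite derivM intpD !hornerM => <-.
by rewrite addrAC subrr add0r.
Qed.

(** Integration by parts n times; the hypothesis kills every boundary term. *)
Lemma intp_derivn u f n :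
  (forall k, (k < n)%N -> f^`(k).[1] = 0 /\ f^`(k).[-1] = 0) ->
  intp (u * f^`(n)) = (-1) ^+ n * intp (u^`(n) * f).
Proof.
elim: n u => [|n IHn] u f0; first by rewrite !derivn0 expr0 mul1r.
rewrite derivnS intp_parts; have [-> ->] := f0 n (ltnSn n).
rewrite !mulr0 subr0 add0r IHn => [|k lt_kn]; last by apply: f0; exact: ltnW.
by rewrite derivSn exprS; ring.
Qed.

(** Integration by parts trades a factor [1 - 'X] for a factor [1 + 'X]. The case m = n = p is the
    integral of (1 - x^2)^p, from which the threshold [c_minus] arises. *)
Lemma intp_beta m n :
  intp ((1 - 'X) ^+ m * (1 + 'X) ^+ n) * (m + n).+1`!%:R =
  2 ^+ (m + n).+1 * m`!%:R * n`!%:R.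
Proof.
have derivX1 k : ((1 + 'X) ^+ k.+1)^`() = k.+1%:R *: (1 + 'X) ^+ k :> {poly F}.
  by rewrite deriv_exp derivD derivC derivX add0r mul1r scaler_nat.
have derivN1 k : ((1 - 'X) ^+ k.+1)^`() = - k.+1%:R *: (1 - 'X) ^+ k :> {poly F}.
  rewrite deriv_exp derivB derivC derivX sub0r mulN1r mulNrn.
  by rewrite scaleNr scaler_nat.
elim: m n => [|m IHm] n.
  rewrite expr0 mul1r add0n fact0 mulr1 factS natrM mulrA; congr (_ * _).
  have := intp_deriv ((1 + 'X) ^+ n.+1); rewrite derivX1 intpZ !hornerE.
  by rewrite subrr expr0n subr0 mulrC.
have := intp_parts ((1 - 'X) ^+ m.+1) ((1 + 'X) ^+ n.+1).
rewrite derivX1 derivN1 intpZr intpZl mulNr !hornerE.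
rewrite !subrr !expr0n /= !mul0r mulr0 subrr sub0r opprK => eq_parts.
have n1_neq0 : (n.+1%:R : F) != 0 by rewrite pnatr_eq0.
apply: (mulfI n1_neq0); rewrite mulrA eq_parts addSnnS -[LHS]mulrA IHm.
by rewrite !factS !natrM; ring.
Qed.

End PolynomialIntegral.

Lemma intp_map (F K : numFieldType) (f : {rmorphism F -> K}) (q : {poly F}) :
  intp (map_poly f q) = f (intp q).
Proof.
rewrite -[q in LHS]deriv_primp -deriv_map intp_deriv /intp rmorphB -!horner_map.
by rewrite rmorph1 rmorphN1.
Qed.

(** Product rule for q^n s, where e stands for q^(n-1). *)
Lemma deriv_exp_mulE (K : comPzRingType) (q q' s s' e : K) n :
  q' * e *+ n * s + q * e * s' = e * (q' * s *+ n + q * s').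
Proof. by rewrite -(mulr_natr (q' * e)) -(mulr_natr (q' * s)); ring. Qed.

(** * Top derivatives and the Rodrigues polynomial (1 - x^2)^n *)

Section TopDerivative.
Variable F : numFieldType.
Implicit Types (q : {poly F}).

Lemma derivn_top q n : (size q <= n.+1)%N -> q^`(n) = (q`_n *+ n`!)%:P.
Proof.
move=> sz_q; apply/polyP => -[|i]; rewrite coef_derivn coefC /= ?addn0 ?ffactnn//.
by rewrite nth_default ?mul0rn //; apply: leq_trans sz_q _; lia.
Qed.

(** Each derivative costs at most one factor 1 - x^2, so the k-th one keeps n - k > 0 of them. *)
Lemma Rodrigues_boundary n k : (k < n)%N ->
  ((1 - 'X^2) ^+ n : {poly F})^`(k).[1] = 0 /\ ((1 - 'X^2) ^+ n :
    {poly F})^`(k).[-1] = 0.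
Proof.
move=> lt_kn.
have [s ->] : exists s, ((1 - 'X^2) ^+ n : {poly F})^`(k) =
  (1 - 'X^2) ^+ (n - k) * s.
  elim: k lt_kn => [|k IHk] lt_kn; first by exists 1; rewrite subn0 mulr1.
  have [s es] := IHk (ltnW lt_kn).
  exists ((1 - 'X^2)^`() * s *+ (n - k) + (1 - 'X^2) * s^`()).
  have -> : (n - k.+1 = (n - k).-1)%N by lia.
  rewrite derivnS es derivM deriv_exp; have : (0 < n - k)%N by lia.
  case: (n - k)%N => // j _; rewrite (exprS _ j); exact: deriv_exp_mulE.
have nk0 : (n - k == 0)%N = false by lia.
by rewrite !hornerE expr1n sqrrN expr1n subrr !expr0n nk0 !mul0r.
Qed.

End TopDerivative.

(** * Residual of the exact dispersion relation *)

Lemma poly_order (F : comNzRingType) m (q : {poly F}) : (forall j, (j < m)%N ->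
  q`_j = 0) ->
  exists S : {poly F}, forall x, q.[x] = x ^+ m * (q`_m + x * S.[x]).
Proof.
move=> q0; exists (drop_poly m.+1 q) => x.
have qE : q = 'X^m * ((q`_m)%:P + 'X * drop_poly m.+1 q).
  apply/polyP => j; rewrite coefXnM; case: ltnP => [/q0 //|le_mj].
  rewrite coefD coefC coefXM coef_drop_poly subn_eq0.
  case: ltngtP le_mj => // [lt_mj _|<- _]; last by rewrite addr0.
  by rewrite add0r; congr (q`_ _); lia.
by rewrite {1}qE !hornerE.
Qed.

Section Residual.
Variables (F : numFieldType) (p : nat) (L : {poly F}).
Hypothesis size_L : (size L <= p.+1)%N.
Implicit Types (mu x : F).

(** P and Q of the overview are the cases x = 1 and x = -1. *)
Definition symb x : {poly F} := \sum_(k < p.+1) L^`(k).[x] *: 'X^(p - k).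

Definition exp_trunc n : {poly F} := \sum_(j < n.+1) j`!%:R^-1 *: 'X^j.

Definition defect j : F := (- 2) ^+ j - intp (L * ('X - 1) ^+ j).

(** The double sum of [symb] with the roles exchanged: mu is a parameter, so that it can be
    differentiated and integrated in x. *)
Definition symb_poly mu : {poly F} := \sum_(k < p.+1) mu ^+ (p - k) *: L^`(k).

Definition shifted_exp n mu : {poly F} :=
  \sum_(j < n.+1) ((- mu) ^+ j / j`!%:R) *: ('X - 1) ^+ j.

(** The integral of (x - 1)^n against [symb_poly], as a polynomial in mu; it carries the truncation
    error of [shifted_exp]. *)
Definition residual_rem n : {poly F} :=
  \sum_(k < p.+1) intp (L^`(k) * ('X - 1) ^+ n) *: 'X^(p - k).

Lemma horner_symb x mu : (symb x).[mu] = (symb_poly mu).[x].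
Proof.
rewrite !horner_sum; apply: eq_bigr => k _.
by rewrite !hornerZ hornerXn mulrC.
Qed.

(** The sum shifts by one index because L^(p+1) = 0; only the term k = 0 is left over. *)
Lemma deriv_symb_poly mu :
  (symb_poly mu)^`() = mu *: symb_poly mu - mu ^+ p.+1 *: L.
Proof.
rewrite /symb_poly [in RHS]big_ord_recl subn0 derivn0 scalerDr scalerA -exprS.
rewrite addrAC subrr add0r raddf_sum /= big_ord_recr /= subnn expr0 scale1r.
rewrite -derivnS (derivn_poly0 size_L) addr0 scaler_sumr.
apply: eq_bigr => i _; rewrite derivZ -derivnS scalerA -exprS /bump /= add1n.
by rewrite subnSK.
Qed.

(** Truncation spoils T' = -mu T only by the top Taylor term. *)
Lemma deriv_shifted_exp n mu :
  (shifted_exp n mu)^`() =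
  - mu *: (shifted_exp n mu - ((- mu) ^+ n / n`!%:R) *: ('X - 1) ^+ n).
Proof.
rewrite /shifted_exp [in RHS]big_ord_recr /= addrK raddf_sum big_ord_recl /=.
rewrite derivZ expr0 derivC scaler0 add0r scaler_sumr; apply: eq_bigr => i _.
rewrite derivZ deriv_exp derivB derivX derivC subr0 mul1r /bump /= add1n.
rewrite -[_ *+ i.+1]scaler_nat !scalerA factS exprS natrM; congr (_ *: _).
have i1 : i.+1%:R != 0 :> F by rewrite pnatr_eq0.
have i2 : i`!%:R != 0 :> F by rewrite pnatr_eq0 -lt0n fact_gt0.
by move: i.+1%:R i`!%:R i1 i2 => a b a0 b0; field; rewrite a0 b0.
Qed.

Lemma horner_shifted_exp1 n mu : (shifted_exp n mu).[1] = 1.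
Proof.
rewrite horner_sum big_ord_recl !hornerE fact0 invr1.
by rewrite big1 ?addr0 // => i _; rewrite !hornerE subrr expr0n mulr0.
Qed.

Lemma horner_shifted_expN1 n mu : (shifted_exp n mu).[-1] = (exp_trunc n).[2 * mu].
Proof.
rewrite !horner_sum; apply: eq_bigr => i _; rewrite !hornerE.
by rewrite mulrAC -exprMn mulrC; congr (_ * _ ^+ _); ring.
Qed.

(** In the derivative of T S, with S = [symb_poly mu], the terms mu T S cancel. What remains is
    -mu^(p+1) T L and the truncation term; T(-1) supplies the powers (-2)^j of the defects. *)
Lemma residual_expansion n mu :
  (symb 1).[mu] - (exp_trunc n).[2 * mu] * ((symb (-1)).[mu] - mu ^+ p.+1) =
  mu ^+ p.+1 * (\sum_(j < n.+1) (- mu) ^+ j / j`!%:R * defect j)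
  + mu * ((- mu) ^+ n / n`!%:R * (residual_rem n).[mu]).
Proof.
have -> : \sum_(j < n.+1) (- mu) ^+ j / j`!%:R * defect j =
    (exp_trunc n).[2 * mu] - intp (L * shifted_exp n mu).
  rewrite -horner_shifted_expN1 mulr_sumr intp_sum horner_sum -sumrB.
  apply: eq_bigr => j _; rewrite intpZr !hornerE /defect mulrBr.
  by congr (_ * _ ^+ _ - _); ring.
have -> : (residual_rem n).[mu] = intp (('X - 1) ^+ n * symb_poly mu).
  rewrite mulr_sumr intp_sum horner_sum; apply: eq_bigr => k _.
  by rewrite !hornerE intpZr mulrC [_ ^`(k) * _]mulrC.
have := intp_deriv (shifted_exp n mu * symb_poly mu).
rewrite derivM deriv_shifted_exp deriv_symb_poly !hornerM horner_shifted_exp1.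
rewrite horner_shifted_expN1 -!horner_symb mul1r.
rewrite intpD intpZl intpBl intpZl intpBr !intpZr.
rewrite [_ * L]mulrC.
move: (symb 1).[mu] (symb (-1)).[mu] (exp_trunc n).[2 * mu] (_ / _).
move: (intp _) (intp _) (intp _) => a b d s1 s2 e x eqs.
have -> : s1 - e * (s2 - mu ^+ p.+1) = (s1 - e * s2) + e * mu ^+ p.+1 by ring.
by rewrite -eqs; ring.
Qed.

(** With truncation order p + 1 + m the remainder is divisible by mu^(p+2+m), so it does not reach
    the leading coefficient. *)
Lemma residual_leading m : (forall j, (j < m)%N -> defect j = 0) ->
  exists S : {poly F}, forall mu,
  (symb 1).[mu] - (exp_trunc (p.+1 + m)).[2 * mu] * ((symb (-1)).[mu] - mu ^+ p.+1)
    =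
  mu ^+ (p.+1 + m) * ((-1) ^+ m / m`!%:R * defect m + mu * S.[mu]).
Proof.
move=> defect0; set n := (p.+1 + m)%N.
pose q : {poly F} := \poly_(j < n.+1) ((-1) ^+ j / j`!%:R * defect j).
have lt_mn : (m < n.+1)%N by rewrite /n; lia.
have [S qS] : exists S : {poly F}, forall x, q.[x] = x ^+ m * (q`_m + x * S.[x]).
  apply: poly_order => j lt_jm; rewrite coef_poly.
  by rewrite defect0 // mulr0 if_same.
exists (S + ((-1) ^+ n / n`!%:R) *: residual_rem n) => mu.
rewrite residual_expansion.
have -> : \sum_(j < n.+1) (- mu) ^+ j / j`!%:R * defect j = q.[mu].
  rewrite horner_poly; apply: eq_bigr => j _.
  by rewrite [(- mu) ^+ j]exprNn; move: (defect j) => d; ring.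
rewrite qS coef_poly lt_mn [(- mu) ^+ n]exprNn hornerD hornerZ.
move: (defect m) S.[mu] (residual_rem n).[mu] (_ / m`!%:R) (n`!%:R^-1) => d s r x y.
by rewrite [mu ^+ n]exprD; move: ((-1) ^+ n) => z; ring.
Qed.

End Residual.

(** * Integrals of real polynomials and positivity *)

Section RealIntegral.
Variable R : realType.
Implicit Types (q u v : {poly R}).

Lemma Rintegral_poly q :
  \int[lebesgue_measure]_(x in `[(-1 : R), 1]) q.[x] = intp q.
Proof.
have lt_N11 : (-1 : R) < 1 by lra.
rewrite /Rintegral (@continuous_FTC2 _ (horner q) (horner (primp q)) _ _ lt_N11) //.
- exact/continuous_subspaceT/continuous_horner.
- split=> [x _||]; first exact: derivable_horner.
  + exact/cvg_at_right_filter/continuous_horner.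
  + exact/cvg_at_left_filter/continuous_horner.
- by move=> x _; rewrite -derivE deriv_primp.
Qed.

Lemma poly_eq0_itv q (a b : R) : a < b ->
  (forall x, a < x < b -> q.[x] = 0) -> q = 0.
Proof.
move=> lt_ab q0; apply/eqP; apply: contraT => q_neq0.
(* These are [size q] distinct points, more than the degree allows as roots; the denominator [i.+2]
   keeps them strictly between a and b. *)
pose rs := [seq a + (b - a) / i.+2%:R | i <- iota 0 (size q)].
have /(max_poly_roots q_neq0) : all (root q) rs.
  apply/allP => x /mapP[i _ ->]; apply/rootP/q0.
  rewrite ltrDl divr_gt0 ?subr_gt0 //= -ltrBrDl ltr_pdivrMr //.
  by rewrite ltr_pMr ?subr_gt0 // ltr1n.
rewrite size_map size_iota ltnn => -> //.
rewrite map_inj_uniq ?iota_uniq // => i j /addrI /mulfI.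
by rewrite subr_eq0 gt_eqF // => /(_ isT) /invr_inj /eqP; rewrite eqr_nat => /eqP[].
Qed.

(** The antiderivative vanishing at -1 is nondecreasing and vanishes at 1 as well, hence is zero on
    the whole interval. *)
Lemma intp_eq0 q : (forall x, -1 < x < 1 -> 0 <= q.[x]) -> intp q = 0 -> q = 0.
Proof.
move=> q_ge0 q0; pose P := primp q - (primp q).[-1]%:P.
have P'E : P^`() = q by rewrite derivB derivC subr0 deriv_primp.
have ndecr : forall x y, -1 <= x -> x <= y -> y <= 1 -> P.[x] <= P.[y].
  apply: ger0_derive1_ndecr => [x _|x|].
  - exact: derivable_horner.
  - by rewrite in_itv /= => x11; rewrite -derivE P'E q_ge0.
  - exact/continuous_subspaceT/continuous_horner.
have PN1 : P.[-1] = 0 by rewrite !hornerE subrr.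
have P1 : P.[1] = 0 by rewrite hornerD hornerN hornerC.
suff P0 : P = 0 by rewrite -P'E P0 deriv0.
apply: (@poly_eq0_itv _ (-1) 1) => [|x /andP[/ltW xN1 /ltW x1]]; first by lra.
by apply/eqP; rewrite eq_le -{1}P1 -{1}PN1 !ndecr.
Qed.

End RealIntegral.

(** * The representer of evaluation at -1 and its defects *)

Section Representer.
Variables (R : realType) (p : nat) (c : R).
Implicit Types (q u v L : {poly R}).

(* The bilinear form of [M + K] in terms of polynomials of degree at most [p]:
   the [p]-th derivative is the constant [p! u_p]. *)
Definition esfr_form u v : R := intp (u * v) + c * p`!%:R ^+ 2 * u`_p * v`_p.

Lemma coef_top_Rodrigues : ((1 - 'X^2) ^+ p : {poly R})`_(2 * p) = (-1) ^+ p.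
Proof.
have -> : (1 - 'X^2 : {poly R}) = - 1 *: ('X^2 - 1%:P).
  by rewrite scaleN1r opprB.
rewrite exprZn coefZ.
have sz2 : size ('X^2 - 1%:P : {poly R}) = 3%N by rewrite size_XnsubC.
have := lead_coef_exp ('X^2 - 1%:P : {poly R}) p.
rewrite lead_coefXnsubC // expr1n lead_coefE size_exp sz2 => ->.
by rewrite mulr1.
Qed.

(** Testing with [v], a multiple of the Legendre polynomial of degree p, gives (-1)^p p! u_p (I((1 -
    x^2)^p) + c (2p)!), whose last factor is positive exactly when c > [c_minus]. Hence u_p = 0, and
    the form at (u, u) becomes the integral of u^2. *)
Lemma esfr_form_nondegenerate u : c_minus R p < c -> (size u <= p.+1)%N ->
  (forall v, (size v <= p.+1)%N -> esfr_form u v = 0) -> u = 0.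
Proof.
move=> c_gt sz_u orth_u; pose q : {poly R} := (1 - 'X^2) ^+ p.
pose v := q^`(p).
have sz_v : (size v <= p.+1)%N.
  apply/leq_sizeP => j lt_pj; rewrite coef_derivn nth_default ?mul0rn //.
  have := size_poly_exp_leq (1 - 'X^2 : {poly R}) p.
  have : (size (1 - 'X^2 : {poly R})%R = 3)%N.
    by rewrite -opprB size_polyN -polyC1 size_XnsubC.
  by move=> -> /leq_trans -> //=; lia.
have v_p : p`!%:R * v`_p = (-1) ^+ p * (2 * p)`!%:R.
  rewrite coef_derivn addnn -mul2n coef_top_Rodrigues -(mulr_natr ((-1) ^+ p))
    mulrCA -natrM.
  have <- : ((2 * p) ^_ p * p`! = (2 * p)`!)%N.
    by rewrite -(@ffact_fact (2 * p) p); [congr (_ * _`!)%N | ]; lia.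
  by rewrite [(p`! * _)%N]mulnC.
have intq : intp q * (2 * p).+1`!%:R = 2 ^+ (2 * p).+1 * p`!%:R ^+ 2.
  have := intp_beta R p p; rewrite -exprMn addnn -mul2n -subr_sqr expr1n => ->.
  by rewrite expr2 mulrA.
have u_p : u`_p = 0.
  have := orth_u v sz_v; rewrite /esfr_form intp_derivn; last first.
    by move=> k; apply: Rodrigues_boundary.
  rewrite derivn_top // mul_polyC intpZ -(mulr_natr u`_p) => eq0.
  have : u`_p * (p`!%:R * (intp q + c * (2 * p)`!%:R)) = 0.
    apply: (@mulfI _ ((-1) ^+ p)); first by rewrite signr_eq0.
    rewrite mulr0 -[RHS]eq0; move: v_p (intp q) => v_p I.
    have -> : c * p`!%:R ^+ 2 * u`_p * v`_p = c * p`!%:R * u`_p * (p`!%:R * v`_p).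
      by ring.
    by rewrite v_p; ring.
  move/eqP; rewrite !mulf_eq0 => /or3P[/eqP //| |].
    by rewrite pnatr_eq0 eqn0Ngt fact_gt0.
  rewrite gt_eqF //.
  have f_gt0 k : (0 : R) < k`!%:R by rewrite ltr0n fact_gt0.
  rewrite -(pmulr_lgt0 _ (f_gt0 (2 * p).+1)) mulrDl intq factS natrM.
  move: c_gt; rewrite /c_minus ltrNl ltr_pdivlMr ?mulr_gt0 ?exprn_gt0 //.
  have := f_gt0 (2 * p)%N.
  move: (2 ^+ _) ((2 * p)`!%:R) (p`!%:R) ((2 * p).+1%:R) => a b d e b0; nra.
have := orth_u u sz_u; rewrite /esfr_form u_p mulr0 addr0.
move/intp_eq0 => uu; apply/eqP; rewrite -sqrf_eq0 expr2 uu // => x _.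
by rewrite hornerM -expr2 sqr_ge0.
Qed.

Variable L : {poly R}.
Hypothesis size_L : (size L <= p.+1)%N.
Hypothesis L_repr : forall v, (size v <= p.+1)%N -> esfr_form L v = v.[-1].

Lemma repr_neq0 : L != 0.
Proof.
apply: contra_neq (oner_neq0 R) => L0.
have := L_repr (v := 1); rewrite size_polyC oner_neq0 => /(_ isT).
by rewrite hornerC /esfr_form L0 mul0r intp0 coef0 mulr0 mul0r addr0.
Qed.

Lemma size_1DX : size (1 + 'X : {poly R})%R = 2%N.
Proof. by rewrite [(1 + 'X)%R]addrC -[(1 : {poly R})%R]polyC1 size_XaddC. Qed.

(** The integrand (1 + x) L^2 is nonnegative on the interval. As (1 + X) L vanishes at -1,
    integration against L cannot act on it as evaluation at -1; the nonvanishing results below rest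
    on this clash. *)
Lemma intp_weighted_neq0 : intp (L * ((1 + 'X) * L)) != 0.
Proof.
apply: contraNneq repr_neq0 => /intp_eq0 eq0.
have : L * ((1 + 'X) * L) = 0.
  apply: eq0 => x /andP[xN1 _]; rewrite !hornerM hornerD hornerX hornerC.
  by rewrite mulrCA mulr_ge0 -?expr2 ?sqr_ge0 //; lra.
move/eqP; rewrite !mulf_eq0 => /or3P[||] //.
by move=> X0; have := size_1DX; rewrite (eqP X0) size_poly0.
Qed.

Lemma size_weighted q : (size ((1 + 'X) * q)%R <= (size q).+1)%N.
Proof.
by apply: leq_trans (size_polyMleq _ _) _; rewrite size_1DX.
Qed.

(** If L_p were 0, then (1 + X) L would be an admissible test polynomial and the form would reduce
    to the integral, giving the value 0 at -1. *)
Lemma repr_lead_neq0 : L`_p != 0.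
Proof.
apply: contraNneq intp_weighted_neq0 => Lp.
have sz_L : (size L <= p)%N.
  apply/leq_sizeP => j; rewrite leq_eqVlt => /predU1P[<- //|lt_pj].
  by apply: nth_default; apply: leq_trans size_L _.
have := L_repr (leq_trans (size_weighted L) (sz_L : _ < p.+1)%N).
rewrite /esfr_form Lp mulr0 mul0r addr0 => ->.
by rewrite !hornerE subrr mul0r.
Qed.

Lemma size_XsubC_exp k : size (('X - 1) ^+ k : {poly R})%R = k.+1.
Proof. by rewrite -polyC1 size_exp_XsubC. Qed.

Lemma coef_XsubC_exp k : (('X - 1) ^+ k : {poly R})`_k = 1.
Proof.
have := lead_coef_exp ('X - 1 : {poly R}) k.
by rewrite lead_coefE size_XsubC_exp -polyC1 lead_coefXsubC expr1n.
Qed.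

(** (X - 1)^k is an admissible test polynomial with value (-2)^k at -1, so its defect is the
    correction term of the form. *)
Lemma defect_le k : (k <= p)%N ->
  defect L k = c * p`!%:R ^+ 2 * L`_p * (('X - 1) ^+ k)`_p.
Proof.
move=> le_kp; have := L_repr (v := ('X - 1) ^+ k).
rewrite size_XsubC_exp => /(_ le_kp).
by rewrite /esfr_form /defect !hornerE -opprD => <-; rewrite addrAC subrr add0r.
Qed.

Lemma defect_lt k : (k < p)%N -> defect L k = 0.
Proof.
move=> lt_kp; rewrite defect_le ?(ltnW lt_kp) // [X in _ * X]nth_default ?mulr0 //.
by rewrite size_XsubC_exp.
Qed.

Lemma defect_top : defect L p = c * p`!%:R ^+ 2 * L`_p.
Proof. by rewrite defect_le // coef_XsubC_exp mulr1. Qed.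

(* Otherwise evaluation at [-1] would agree with [intp (L * _)] in degree
   [p + 1] too, in particular at [(1 + 'X) * L]. *)
Lemma defect_succ_neq0 : c = 0 -> defect L p.+1 != 0.
Proof.
move=> c0; apply: contraNneq intp_weighted_neq0 => def0.
(* Subtracting a multiple of the monic (X - 1)^(p+1) leaves [r] of degree at most p, where [L_repr]
   applies; [def0] covers the subtracted part. *)
set v := (1 + 'X) * L; pose a := v`_p.+1; pose r := v - a *: ('X - 1) ^+ p.+1.
have sz_r : (size r <= p.+1)%N.
  have sz_v : (size v <= p.+2)%N by apply: leq_trans (size_weighted L) _.
  apply/leq_sizeP => j; rewrite leq_eqVlt coefB coefZ => /predU1P[<-|lt_pj].
    by rewrite coef_XsubC_exp mulr1 subrr.
  by rewrite !nth_default ?mulr0 ?subrr ?size_XsubC_exp //; apply: leq_trans sz_v _.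
have := L_repr sz_r; rewrite /esfr_form c0 !mul0r addr0 => r_repr.
have -> : v = r + a *: ('X - 1) ^+ p.+1 by rewrite subrK.
rewrite mulrDr intpD intpZr r_repr /r.
move/eqP: def0; rewrite subr_eq0 => /eqP <-.
by rewrite !hornerE subrr mul0r sub0r -opprD addNr.
Qed.

Lemma defect_order : exists2 m, m = (if c == 0 then p.+1 else p) &
  (forall j, (j < m)%N -> defect L j = 0) /\ defect L m != 0.
Proof.
case: eqVneq => [c0|c_neq0].
  exists p.+1 => //; split=> [j|]; last exact: defect_succ_neq0.
  by rewrite ltnS leq_eqVlt => /predU1P[->|/defect_lt //];
    rewrite defect_top c0 !mul0r.
exists p => //; split=> [j /defect_lt //|].
by rewrite defect_top !mulf_neq0 ?repr_lead_neq0 ?expf_neq0 // pnatr_eq0 -lt0n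
  fact_gt0.
Qed.

End Representer.

(** * Eigenvalues of a rank-one update of a nilpotent matrix *)

Section RankOneUpdate.
Variables (F : fieldType) (p : nat).
Implicit Types (A D : 'M[F]_p.+1) (mu : F).

(** Passes from row to column eigenvectors through the determinant of the transpose. *)
Lemma eigenvalue_colP A mu :
  reflect (exists2 u : 'cV_p.+1, A *m u = mu *: u & u != 0) (eigenvalue A mu).
Proof.
have -> : eigenvalue A mu = (\det (A - mu%:M)^T == 0).
  rewrite det_tr; apply/eigenvalueP/det0P => [[v Av v0]|[v v0 Av]]; exists v => //.
    by rewrite mulmxBr Av mul_mx_scalar subrr.
  by move/eqP: Av; rewrite mulmxBr mul_mx_scalar subr_eq0 => /eqP.
apply: (iffP det0P) => [[v v0 Av]|[u Au u0]].
  exists v^T; last by rewrite -trmx0 (inj_eq trmx_inj).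
  move/(congr1 trmx): Av; rewrite trmx_mul trmxK trmx0 mulmxBl mul_scalar_mx.
  by move/eqP; rewrite subr_eq0 => /eqP.
exists u^T; first by rewrite -trmx0 (inj_eq trmx_inj).
by rewrite -trmx_mul mulmxBl mul_scalar_mx Au subrr trmx0.
Qed.

Variables (D : 'M[F]_p.+1) (k : 'cV[F]_p.+1) (a : 'rV[F]_p.+1).
Hypothesis D_nil : D ^+ p.+1 = 0.
Hypothesis Dk_neq0 : D ^+ p *m k != 0.
Hypothesis ker_D : forall u : 'cV_p.+1, D *m u = 0 ->
  exists t, u = t *: (D ^+ p *m k).

(** This is mu^(p+1) times the Neumann series of (mu - D)^-1; clearing denominators keeps mu = 0
    available. *)
Definition nil_adj mu : 'M[F]_p.+1 := \sum_(j < p.+1) mu ^+ (p - j) *: D ^+ j.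

Lemma mul_nil_adj mu : (mu%:M - D) *m nil_adj mu = (mu ^+ p.+1)%:M.
Proof.
have comm_muD : GRing.comm mu%:M D by apply: esym; apply: scalar_mxC.
have := subrXX_comm p.+1 comm_muD; rewrite D_nil subr0 -rmorphXn /= => ->.
congr (_ *m _); apply: eq_bigr => j _.
by rewrite -rmorphXn /= -mul_scalar_mx.
Qed.

Lemma nil_adj_mul mu : nil_adj mu *m (mu%:M - D) = (mu ^+ p.+1)%:M.
Proof.
rewrite -mul_nil_adj mulmxBl mulmxBr -scalar_mxC; congr (_ - _).
rewrite mulmx_suml mulmx_sumr; apply: eq_bigr => j _.
rewrite -scalemxAr -scalemxAl; congr (_ *: _).
by rewrite -[LHS]exprSr -[RHS]exprS.
Qed.

(** The hypotheses make D a single nilpotent Jordan block with cyclic vector k. An eigenvector u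
    satisfies (mu - D) u = k (a u); applying [nil_adj] and then a gives the scalar equation
    multiplied by a u. *)
Lemma eigenvalue_rank_one mu :
  eigenvalue (D + k *m a) mu =
  (mu ^+ p.+1 == \sum_(j < p.+1) mu ^+ (p - j) * (a *m D ^+ j *m k) 0 0).
Proof.
pose B := nil_adj mu.
have aBk : a *m B *m k =
    (\sum_(j < p.+1) mu ^+ (p - j) * (a *m D ^+ j *m k) 0 0)%:M.
  rewrite mulmx_sumr mulmx_suml [LHS]mx11_scalar summxE; congr (scalar_mx _).
  by apply: eq_bigr => j _; rewrite -scalemxAr -scalemxAl mxE.
move: (\sum_(j < _) _) aBk => s aBk.
apply/eigenvalue_colP/eqP => [[u eq_u u_neq0]|eq_mu].
  have eqD : (mu%:M - D) *m u = k *m (a *m u).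
    by rewrite mulmxBl mul_scalar_mx -eq_u mulmxDl addrAC subrr add0r mulmxA.
  have eqB : mu ^+ p.+1 *: u = B *m k *m (a *m u).
    by rewrite -mulmxA -eqD mulmxA nil_adj_mul mul_scalar_mx.
  have [au0|au_neq0] := eqVneq (a *m u) 0; last first.
    have : (mu ^+ p.+1 - s) *: (a *m u) = 0.
      rewrite scalerBl scalemxAr eqB !mulmxA aBk -mulmxA mul_scalar_mx.
      by rewrite subrr.
    by move/eqP; rewrite scaler_eq0 (negPf au_neq0) orbF subr_eq0 => /eqP.
  (* If a u = 0, then mu = 0 and u spans the kernel of D; the sum reduces to a D^p k, which is
     proportional to a u = 0. *)
  have mu0 : mu = 0.
    move/eqP: eqB; rewrite au0 mulmx0 scaler_eq0 (negPf u_neq0) orbF expf_eq0.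
    by move=> /andP[_ /eqP].
  have Du : D *m u = 0.
    by apply/eqP; rewrite -oppr_eq0 -[- _]add0r -{1}(scale0r u) -mu0 -mul_scalar_mx
      -mulmxBl eqD au0 mulmx0.
  have [t ut] := ker_D Du.
  have t0 : t != 0 by apply: contraNneq u_neq0 => t0; rewrite ut t0 scale0r.
  have : s%:M = 0 :> 'M[F]_1.
    rewrite -aBk /B /nil_adj big_ord_recr /= big1 ?add0r => [|i _]; last first.
      by rewrite mu0 expr0n subn_eq0 leqNgt ltn_ord scale0r.
    rewrite subnn expr0 scale1r -mulmxA; apply: (scalerI t0).
    by rewrite scalemxAr -ut au0 scaler0.
  move/(congr1 (fun A : 'M[F]_1 => A 0 0)); rewrite !mxE eqxx mulr1n => ->.
  by rewrite mu0 expr0n.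
(* This vector is nonzero: at mu = 0 it is D^p k, and otherwise (mu - D) B k = mu^(p+1) k. *)
exists (B *m k).
  have : (mu%:M - D) *m (B *m k) = (k *m a) *m (B *m k).
    rewrite [LHS]mulmxA mul_nil_adj eq_mu -[RHS]mulmxA (mulmxA a) aBk.
    by rewrite mul_scalar_mx mul_mx_scalar.
  by rewrite mulmxBl mul_scalar_mx mulmxDl => <-; rewrite addrC subrK.
have [mu0|mu_neq0] := eqVneq mu 0.
  rewrite /B /nil_adj big_ord_recr /= big1 ?add0r ?subnn ?expr0 ?scale1r // => i _.
  by rewrite mu0 expr0n subn_eq0 leqNgt ltn_ord scale0r.
apply: contra_neq (Dk_neq0) => Bk0.
suff -> : k = 0 by rewrite mulmx0.
apply: (scalerI (expf_neq0 p.+1 mu_neq0)).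
by rewrite scaler0 -mul_scalar_mx -mul_nil_adj -mulmxA Bk0 mulmx0.
Qed.

Lemma eigenvalueZ (A : 'M[F]_p.+1) t mu : t != 0 ->
  eigenvalue (t *: A) (t * mu) = eigenvalue A mu.
Proof.
move=> t0; apply/eigenvalueP/eigenvalueP => -[v Av v0]; exists v => //.
  by apply: (scalerI t0); rewrite scalemxAr Av scalerA.
by rewrite -scalemxAr Av scalerA.
Qed.

End RankOneUpdate.

(** * The ESFR matrices in terms of polynomials *)

Section Coordinates.
Variables (R : realType) (p : nat) (chi : (p.+1).-tuple {poly_p.+1 R}).
Hypothesis chi_basis : basis_of fullv chi.
Implicit Types (x y : 'cV[R]_p.+1) (v : {poly R}).

Local Notation D := (diff_mx chi).

Definition poly_of x : {poly R} := \sum_j x j 0 *: val (tnth chi j).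

Lemma poly_ofE x : poly_of x = val (\sum_j x j 0 *: tnth chi j).
Proof. by rewrite raddf_sum. Qed.

Lemma size_poly_of x : (size (poly_of x) <= p.+1)%N.
Proof. by rewrite poly_ofE size_npoly. Qed.

Lemma poly_of_inj x : poly_of x = 0 -> x = 0.
Proof.
rewrite poly_ofE => poly0.
have eq0 : \sum_j x j 0 *: tnth chi j = 0 by apply: val_inj; rewrite poly0.
apply/colP => i; rewrite mxE.
move/freeP: (basis_free chi_basis) => /(_ (fun j => x j 0)); apply.
rewrite -[RHS]eq0.
by apply: eq_bigr => j _; rewrite (tnth_nth 0).
Qed.

Lemma poly_of_coord (q : {poly_p.+1 R}) : poly_of (\col_i coord chi i q) = val q.
Proof.
rewrite poly_ofE [in RHS](coord_basis chi_basis (memvf q)); congr val.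
by apply: eq_bigr => i _; rewrite mxE (tnth_nth 0).
Qed.

Lemma poly_of_surj v : (size v <= p.+1)%N -> exists x, poly_of x = v.
Proof.
by move=> sz_v; exists (\col_i coord chi i (npolyp p.+1 v));
  rewrite poly_of_coord /= npolypK.
Qed.

Lemma poly_of_mulmx (A : 'M[R]_p.+1) x :
  poly_of (A *m x) = \sum_j x j 0 *: poly_of (col j A).
Proof.
rewrite /poly_of; under eq_bigr do rewrite mxE scaler_suml.
rewrite exchange_big /=; apply: eq_bigr => j _; rewrite scaler_sumr.
by apply: eq_bigr => i _; rewrite scalerA mxE mulrC.
Qed.

Lemma poly_of_diff x : poly_of (D *m x) = (poly_of x)^`().
Proof.
rewrite poly_of_mulmx [in RHS]/poly_of raddf_sum; apply: eq_bigr => j _.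
rewrite /= derivZ; congr (_ *: _).
have -> : col j D = \col_i coord chi i (npoly_deriv (tnth chi j)).
  by apply/colP => i; rewrite !mxE.
rewrite poly_of_coord /= npolypK //.
apply/leq_sizeP => i lt_pi; rewrite coef_deriv nth_default ?mul0rn //.
by rewrite (leq_trans (size_npoly _)) // ltnW.
Qed.

Lemma poly_of_diffn n x : poly_of (D ^+ n *m x) = (poly_of x)^`(n).
Proof.
elim: n => [|n IHn]; first by rewrite expr0 mul1mx.
by rewrite exprS -mulmxA poly_of_diff IHn.
Qed.

Lemma diff_mx_nilpotent : D ^+ p.+1 = 0.
Proof.
apply/matrixP => i j; have : D ^+ p.+1 *m delta_mx j 0 = 0 :> 'cV_p.+1.
  by apply: poly_of_inj; rewrite poly_of_diffn derivn_poly0 // size_poly_of.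
by rewrite -colE => /colP/(_ i); rewrite !mxE.
Qed.

Lemma left_colE x : ((left_col chi)^T *m x) 0 0 = (poly_of x).[-1].
Proof.
rewrite mxE horner_sum; apply: eq_bigr => j _.
by rewrite !mxE hornerZ mulrC.
Qed.

Lemma right_colE x : ((right_col chi)^T *m x) 0 0 = (poly_of x).[1].
Proof.
rewrite mxE horner_sum; apply: eq_bigr => j _.
by rewrite !mxE hornerZ mulrC.
Qed.

Lemma intp_poly_of x v : intp (poly_of x * v) =
  \sum_j x j 0 * intp (val (tnth chi j) * v).
Proof.
rewrite /poly_of mulr_suml; etransitivity; first exact: intp_sum.
by apply: eq_bigr => j _; rewrite intpZl.
Qed.

Lemma mass_mxE x y : (x^T *m mass_mx chi *m y) 0 0 = intp (poly_of x * poly_of y).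
Proof.
rewrite -mulmxA mxE intp_poly_of; apply: eq_bigr => i _.
rewrite !mxE mulrC [_ * poly_of y]mulrC intp_poly_of mulr_suml mulr_sumr.
apply: eq_bigr => j _; rewrite mxE mulrC [_ * y j 0]mulrC; congr (_ * (_ * _)).
by rewrite -Rintegral_poly; apply: eq_Rintegral => t _; rewrite hornerM mulrC.
Qed.

Variable c : R.
Local Notation MK := (mass_mx chi + corr_mx c chi).

(** Both p-th derivatives are constants, and the integral of 1, which is 2, cancels the factor 1/2
    of K. *)
Lemma mass_corr_mxE x y : (x^T *m MK *m y) 0 0 =
  esfr_form p c (poly_of x) (poly_of y).
Proof.
rewrite mulmxDr mulmxDl mxE mass_mxE; congr (_ + _).
rewrite -scalemxAr -scalemxAl mxE.
have -> : x^T *m ((D ^+ p)^T *m mass_mx chi *m D ^+ p) *m y =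
    (D ^+ p *m x)^T *m mass_mx chi *m (D ^+ p *m y) by rewrite trmx_mul !mulmxA.
rewrite mass_mxE !poly_of_diffn !derivn_top ?size_poly_of // -polyCM.
rewrite -[_%:P]mulr1 mul_polyC intpZ.
have := intp_deriv ('X : {poly R}); rewrite derivX !hornerX opprK => ->.
move: (poly_of x)`_p (poly_of y)`_p => s t.
by rewrite -(mulr_natr s) -(mulr_natr t); field.
Qed.

Hypothesis c_gt : c_minus R p < c.

Lemma mass_corr_unitmx : MK \in unitmx.
Proof.
rewrite unitmxE unitfE; apply/det0P => -[v v_neq0 vMK].
case/eqP: v_neq0; suff v0 : v^T = 0 by rewrite -[v]trmxK v0 trmx0.
apply: poly_of_inj; apply: (esfr_form_nondegenerate c_gt); first exact:
  size_poly_of.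
move=> u /poly_of_surj[y <-].
by rewrite -mass_corr_mxE trmxK vMK mul0mx mxE.
Qed.

Definition lift_col : 'cV[R]_p.+1 := invmx MK *m left_col chi.
(** The polynomial L of the overview. *)
Definition lift_poly : {poly R} := poly_of lift_col.

Lemma size_lift_poly : (size lift_poly <= p.+1)%N.
Proof. exact: size_poly_of. Qed.

Lemma esfr_formC (u v : {poly R}) : esfr_form p c u v = esfr_form p c v u.
Proof. by rewrite /esfr_form mulrC mulrAC. Qed.

Lemma lift_poly_repr v : (size v <= p.+1)%N -> esfr_form p c lift_poly v = v.[-1].
Proof.
move=> /poly_of_surj[y <-]; rewrite esfr_formC -mass_corr_mxE /lift_col.
rewrite -mulmxA mulKVmx ?mass_corr_unitmx // -left_colE.
by rewrite -[y^T *m _]trmxK trmx_mul trmxK mxE.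
Qed.

Lemma left_diff_lift n :
  ((left_col chi)^T *m D ^+ n *m lift_col) 0 0 = lift_poly^`(n).[-1].
Proof. by rewrite -mulmxA left_colE poly_of_diffn. Qed.

Lemma right_diff_lift n :
  ((right_col chi)^T *m D ^+ n *m lift_col) 0 0 = lift_poly^`(n).[1].
Proof. by rewrite -mulmxA right_colE poly_of_diffn. Qed.

Lemma poly_of_diff_top : poly_of (D ^+ p *m lift_col) = (lift_poly`_p *+ p`!)%:P.
Proof. by rewrite poly_of_diffn derivn_top ?size_poly_of. Qed.

Lemma lift_top_neq0 : lift_poly`_p *+ p`! != 0.
Proof.
rewrite mulrn_eq0 negb_or -lt0n fact_gt0.
exact: repr_lead_neq0 size_lift_poly lift_poly_repr.
Qed.

Lemma diff_top_neq0 : D ^+ p *m lift_col != 0.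
Proof.
apply: contraNneq lift_top_neq0 => eq0; have := poly_of_diff_top.
rewrite eq0 /poly_of big1 => [|j _]; last by rewrite mxE scale0r.
by move/esym/eqP; rewrite polyC_eq0.
Qed.

(** Only constants have derivative zero, and D^p [lift_col] represents a nonzero constant. The
    row-space form lets the inclusion pass to R[i] by [map_kermx]. *)
Lemma ker_diff_mx : (kermx D^T <= (D ^+ p *m lift_col)^T)%MS.
Proof.
apply/row_subP => i; apply/sub_rVP; set x := row i _.
have Dx : D *m x^T = 0.
  apply: trmx_inj; rewrite trmx_mul trmxK trmx0.
  by rewrite /x -row_mul mulmx_ker row0.
have x'0 : (poly_of x^T)^`() = 0.
  by rewrite -poly_of_diff Dx /poly_of big1 // => j _; rewrite mxE scale0r.
pose t := (poly_of x^T)`_0 / (lift_poly`_p *+ p`!).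
exists t; apply: trmx_inj; apply/eqP; rewrite -subr_eq0; apply/eqP.
apply: poly_of_inj.
have -> : x^T - (t *: (D ^+ p *m lift_col)^T)^T = x^T - t *: (D ^+ p *m lift_col).
  by apply/colP => j; rewrite !mxE.
have -> : poly_of (x^T - t *: (D ^+ p *m lift_col)) =
    poly_of x^T - t *: poly_of (D ^+ p *m lift_col).
  rewrite /poly_of scaler_sumr -sumrB; apply: eq_bigr => j _.
  by rewrite !mxE scalerBl scalerA.
rewrite poly_of_diff_top scale_polyC divfK ?lift_top_neq0 //.
have := primp_deriv (poly_of x^T); rewrite x'0 => <-.
by apply/polyP => j; rewrite coef_primp !coef0 mul0r.
Qed.

End Coordinates.

(** * The characteristic polynomial of the scheme *)

Section CharacteristicEquation.
Variables (R : realType) (p : nat) (chi : (p.+1).-tuple {poly_p.+1 R}).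
Hypothesis chi_basis : basis_of fullv chi.
Variable c : R.
Hypothesis c_gt : c_minus R p < c.

Local Notation rc := (real_complex R).
Local Notation D := (diff_mx chi).

Definition lift_polyC : {poly R[i]} := map_poly rc (lift_poly chi c).

Definition char_esfr (theta : R) : {poly R[i]} :=
  'X^(p.+1) - symb p lift_polyC (-1) + expi (- theta) *: symb p lift_polyC 1.

(** The matrix is -2i (D + k a) with k = (M + K)^-1 l and a = l^T - e^(-i theta) r^T, so
    [eigenvalue_rank_one] applies with omega = -2i mu. *)
Lemma eigenvalue_esfr theta mu :
  eigenvalue (von_neumann_mx c chi theta) (- (2 * 'i%C) * mu) =
    root (char_esfr theta) mu.
Proof.
pose a := map_mx rc (left_col chi)^T - expi (- theta) *:
  map_mx rc (right_col chi)^T.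
pose k := map_mx rc (lift_col chi c).
have -> : von_neumann_mx c chi theta = - (2 * 'i%C) *: (map_mx rc D + k *m a).
  rewrite /von_neumann_mx -/(lift_col chi c) ![map_mx _ (lift_col _ _ *m _)]map_mxM.
  by rewrite [k *m a]mulmxBr -[k *m (_ *: _)]scalemxAr addrA.
rewrite eigenvalueZ; last first.
  by rewrite oppr_eq0 mulf_neq0 ?pnatr_eq0 // eq_complex /= oner_eq0 andbF.
have nilD : map_mx rc D ^+ p.+1 = 0 by rewrite -rmorphXn /= diff_mx_nilpotent //
  map_mx0.
have top : map_mx rc D ^+ p *m k = map_mx rc (D ^+ p *m lift_col chi c).
  by rewrite -rmorphXn /= -map_mxM.
rewrite eigenvalue_rank_one //.
- have -> : \sum_(j < p.+1) mu ^+ (p - j) * (a *m map_mx rc D ^+ j *m k) 0 0 =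
      (symb p lift_polyC (-1)).[mu] - expi (- theta) * (symb p lift_polyC 1).[mu].
    rewrite !horner_sum mulr_sumr -sumrB; apply: eq_bigr => j _.
    have -> : (a *m map_mx rc D ^+ j *m k) 0 0 =
        rc (lift_poly chi c)^`(j).[-1] - expi (- theta) * rc (lift_poly chi
          c)^`(j).[1].
      rewrite -left_diff_lift // -right_diff_lift // -rmorphXn /= !mulmxBl
        -!scalemxAl.
      by rewrite -!map_mxM !mxE.
    have evE x : (lift_polyC^`(j)).[rc x] = rc (lift_poly chi c)^`(j).[x].
      by rewrite derivn_map horner_map.
    have := evE (-1); have := evE 1; rewrite rmorph1 rmorphN1 => <- <-.
    by rewrite !hornerZ !hornerXn; ring.
  rewrite rootE /char_esfr !hornerE -[LHS]subr_eq0; congr (_ == 0); ring.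
- by rewrite top map_mx_eq0 diff_top_neq0.
move=> u Du; rewrite top.
have : (u^T <= map_mx rc (D ^+ p *m lift_col chi c)^T)%MS.
  apply: submx_trans (_ : u^T <= map_mx rc (kermx D^T))%MS _; last first.
    by rewrite map_submx ker_diff_mx.
  by rewrite map_kermx; apply/sub_kermxP; rewrite -map_trmx -trmx_mul Du trmx0.
case/sub_rVP => t ut; exists t; apply: trmx_inj.
by rewrite ut linearZ /= map_trmx.
Qed.

End CharacteristicEquation.

(** * Estimates near the origin *)

Section ComplexModulus.
Variable R : realType.
Implicit Types (x y z : R[i]) (t : R).

Local Notation nc := (@ComplexField.Normc.normc R).
Local Notation rc := (real_complex R).

Lemma nc_ge0 x : 0 <= nc x.
Proof. by case: x => a b; exact: sqrtr_ge0. Qed.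

Lemma ncM x y : nc (x * y) = nc x * nc y.
Proof. exact: ComplexField.Normc.normcM. Qed.

Lemma ncD x y : nc (x + y) <= nc x + nc y.
Proof. exact: le_normcD. Qed.

Lemma ncN x : nc (- x) = nc x.
Proof. exact: normcN. Qed.

Lemma ncB x y : nc (x - y) <= nc x + nc y.
Proof. by rewrite -[in X in _ <= X](ncN y); exact: ncD. Qed.

Lemma ncBC x y : nc (x - y) = nc (y - x).
Proof. by rewrite -ncN opprB. Qed.

Lemma nc_lower x y : nc x - nc y <= nc (x + y).
Proof. by rewrite lerBlDr -{1}(addrK y x) ncB. Qed.

Lemma nc0 : nc 0 = 0.
Proof. exact: ComplexField.Normc.normc0. Qed.

Lemma nc1 : nc 1 = 1.
Proof. exact: ComplexField.Normc.normc1. Qed.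

Lemma nc_eq0 x : (nc x == 0) = (x == 0).
Proof.
by apply/eqP/eqP => [/(@ComplexField.Normc.eq0_normc R)|->] //; exact: nc0.
Qed.

Lemma nc_gt0 x : (0 < nc x) = (x != 0).
Proof. by rewrite lt_def nc_ge0 nc_eq0 andbT. Qed.

Lemma ncX x n : nc (x ^+ n) = nc x ^+ n.
Proof. by elim: n => [|n IHn]; rewrite ?expr0 ?nc1 // !exprS ncM IHn. Qed.

Lemma nc_real t : nc (rc t) = `|t|.
Proof. by rewrite /= expr0n /= addr0 sqrtr_sqr. Qed.

Lemma nc_i : nc 'i%C = 1.
Proof. by rewrite /= expr0n /= add0r expr1n sqrtr1. Qed.

Lemma nc_ReIm (a b : R) : nc (a +i* b)%C <= `|a| + `|b|.
Proof.
rewrite [(a +i* b)%C]complexE; apply: le_trans (ncD _ _) _.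
by rewrite ncM nc_i !nc_real mul1r.
Qed.

Lemma poly_lipschitz (q : {poly R[i]}) : exists2 K, 0 <= K &
  forall x y, nc x <= 1 -> nc y <= 1 -> nc (q.[x] - q.[y]) <= K * nc (x - y).
Proof.
elim/poly_ind: q => [|q b [K K0 IHq]].
  by exists 0 => // x y _ _; rewrite !horner0 subrr nc0 mul0r.
exists (K + (K + nc q.[0])) => [|x y x1 y1]; first by rewrite !addr_ge0 ?nc_ge0.
have qy : nc q.[y] <= K + nc q.[0].
  rewrite -[q.[y]](subrK q.[0]); apply: le_trans (ncD _ _) _; rewrite lerD2r.
  apply: le_trans (IHq _ _ y1 _) _; first by rewrite nc0.
  by rewrite subr0 ler_piMr.
have -> : (q * 'X + b%:P).[x] - (q * 'X + b%:P).[y] =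
    (q.[x] - q.[y]) * x + q.[y] * (x - y) by rewrite !hornerE; ring.
apply: le_trans (ncD _ _) _; rewrite !ncM mulrDl lerD //.
  apply: le_trans (_ : nc (q.[x] - q.[y]) * 1 <= _);
    first by rewrite ler_wpM2l ?nc_ge0.
  by rewrite mulr1 IHq.
by rewrite ler_wpM2r ?nc_ge0.
Qed.

Lemma poly_bounded (q : {poly R[i]}) : exists2 K, 0 <= K &
  forall x, nc x <= 1 -> nc q.[x] <= K.
Proof.
have [K K0 lipq] := poly_lipschitz q.
exists (K + nc q.[0]) => [|x x1]; first by rewrite addr_ge0 ?nc_ge0.
rewrite -[q.[x]](subrK q.[0]); apply: le_trans (ncD _ _) _; rewrite lerD2r.
apply: le_trans (lipq _ _ x1 _) _; first by rewrite nc0.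
by rewrite subr0 ler_piMr.
Qed.

(** The modulus of q(0) is the product of the moduli of the n + 1 roots, which therefore cannot all
    exceed t. *)
Lemma monic_small_root (q : {poly R[i]}) n t : 0 < t -> q \is monic ->
  size q = n.+2 -> nc q.[0] <= t ^+ n.+1 -> exists2 z, root q z & nc z <= t.
Proof.
move=> t0 q_monic sz_q q0.
have [r qE] := closed_field_poly_normal q; rewrite (monicP q_monic) scale1r in qE.
have sz_r : size r = n.+1 by move: sz_q; rewrite qE size_prod_XsubC => -[].
have [|no_root] := boolP (has (fun z => nc z <= t) r).
  by case/hasP => z rz zt; exists z => //; rewrite qE root_prod_XsubC.
suff : t ^+ n.+1 < nc q.[0] by rewrite ltNge q0.
have big : all (fun z => t < nc z) r.
  by apply/allP => z rz; rewrite ltNge; apply: contra no_root => zt; apply/hasP;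
    exists z.
rewrite qE horner_prod -sz_r; have : r != [::] by rewrite -size_eq0 sz_r.
elim: r big {qE sz_r no_root} => // z r IHr /= /andP[tz big] _.
rewrite big_cons ncM exprS hornerXsubC sub0r ncN.
have [->|r_nil] := eqVneq r [::]; first by rewrite big_nil nc1 !mulr1.
by rewrite ltr_pM ?exprn_ge0 ?IHr // ltW.
Qed.

End ComplexModulus.

(** * Taylor bounds for exp(i t) *)

Section ImaginaryExponential.
Variable R : realType.
Implicit Types (x y : R[i]) (t : R).

Local Notation nc := (@ComplexField.Normc.normc R).
Local Notation rc := (real_complex R).

(** Mean value theorem between 0 and t; the gain 1/(n+1) of integration is given up. *)
Lemma derive_le_pow (f df : R -> R) n : f 0 = 0 ->
  (forall t, is_derive t (1 : R) f (df t)) ->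
  (forall t, `|df t| <= `|t| ^+ n) -> forall t, `|f t| <= `|t| ^+ n.+1.
Proof.
move=> f0 dfE df_le.
have f_cont : continuous f.
  move=> t; apply/differentiable_continuous/derivable1_diffP.
  exact: (@ex_derive _ _ _ _ _ _ _ (dfE t)).
(* Serves both signs of t, with [a, b] equal to [0, t] or [t, 0] and s = t. *)
have step a b s : `|a| <= `|s| -> `|b| <= `|s| -> a <= b -> `|b - a| <= `|s| ->
    `|f b - f a| <= `|s| ^+ n.+1.
  move=> a_s b_s ab ba_s.
  have [t] := MVT_segment ab (fun t _ => dfE t) (continuous_subspaceT f_cont).
  rewrite in_itv /= => /andP[at_ tb] ->; rewrite normrM exprSr ler_pM //.
  apply: le_trans (df_le t) _; rewrite lerXn2r ?nnegrE //.
  by move: a_s b_s; rewrite !ler_norml => /andP[? ?] /andP[? ?]; lra.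
move=> t; have [t0|t0] := lerP 0 t.
  by rewrite -[f t]subr0 -f0 step ?normr0 ?subr0.
by rewrite -normrN -[- f t]add0r -f0 step ?normr0 ?sub0r ?normrN // ltW.
Qed.

Definition cos_trunc n : {poly R} := \poly_(j < n) (complex.Re ('i%C ^+ j :
  R[i]) / j`!%:R).
Definition sin_trunc n : {poly R} := \poly_(j < n) (complex.Im ('i%C ^+ j :
  R[i]) / j`!%:R).

Lemma ReM_i x : complex.Re ('i%C * x) = - complex.Im x.
Proof. by case: x => a b /=; ring. Qed.

Lemma ImM_i x : complex.Im ('i%C * x) = complex.Re x.
Proof. by case: x => a b /=; ring. Qed.

Lemma divS_fact (a : R) j : a / j.+1`!%:R *+ j.+1 = a / j`!%:R.
Proof.
have j1 : (j.+1%:R : R) != 0 by rewrite pnatr_eq0.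
have f0 : (j`!%:R : R) != 0 by rewrite pnatr_eq0 -lt0n fact_gt0.
rewrite -(mulr_natr (_ / _)) factS natrM.
by move: j.+1%:R j`!%:R j1 f0 => u v u0 v0; field; rewrite u0 v0.
Qed.

Lemma deriv_cos_trunc n : (cos_trunc n.+1)^`() = - sin_trunc n.
Proof.
apply/polyP => j; rewrite coefN coef_deriv !coef_poly ltnS.
by case: ifP; rewrite ?mul0rn ?oppr0 // exprS ReM_i divS_fact mulNr.
Qed.

Lemma deriv_sin_trunc n : (sin_trunc n.+1)^`() = cos_trunc n.
Proof.
apply/polyP => j; rewrite coef_deriv !coef_poly ltnS.
by case: ifP; rewrite ?mul0rn // exprS ImM_i divS_fact.
Qed.

(** Joint induction: the derivative of either error at n + 1 is, up to sign, the other error at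
    n. *)
Lemma trig_trunc_le n t :
  `|cos t - (cos_trunc n).[t]| <= `|t| ^+ n /\ `|sin t - (sin_trunc n).[t]| <=
    `|t| ^+ n.
Proof.
elim: n t => [|n IHn] t.
  have -> : cos_trunc 0 = 0 by apply/polyP => j; rewrite coef_poly coef0.
  have -> : sin_trunc 0 = 0 by apply/polyP => j; rewrite coef_poly coef0.
  rewrite horner0 !subr0 expr0 !ler_norml.
  by rewrite cos_geN1 cos_le1 sin_geN1 sin_le1.
have sub_poly (f : R -> R) df (P : {poly R}) (s : R) :
    is_derive s (1 : R) f df ->
    is_derive s (1 : R) (fun u => f u - P.[u]) (df - P^`().[s]).
  by move=> f'; apply: (@is_deriveB _ _ _ f (horner P)).
split.
  apply: derive_le_pow (fun s => sub_poly _ _ _ _ (is_derive_cos s)) _ _.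
    by rewrite cos0 horner_coef0 coef_poly /= fact0 divr1 subrr.
  move=> s; rewrite deriv_cos_trunc hornerN opprK addrC distrC.
  exact: (IHn s).2.
apply: derive_le_pow (fun s => sub_poly _ _ _ _ (is_derive_sin s)) _ _.
  by rewrite sin0 horner_coef0 coef_poly /= mul0r subrr.
by move=> s; rewrite deriv_sin_trunc; exact: (IHn s).1.
Qed.

(** [exp_trunc n] includes the power n, whereas [cos_trunc n] stops before it; hence the shift. *)
Lemma exp_trunc_ReIm n t : (exp_trunc R[i] n).[('i * rc t)%C] =
  ((cos_trunc n.+1).[t] +i* (sin_trunc n.+1).[t])%C.
Proof.
rewrite [RHS]complexE /= !horner_poly !raddf_sum /= mulr_sumr -big_split horner_sum.
apply: eq_bigr => j _; rewrite hornerZ hornerXn exprMn -(rmorph_nat rc).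
rewrite -fmorphV -rmorphXn /=; case: ('i%C ^+ j) => a b; simpc.
by congr (_ +i* _)%C; rewrite mulrC -!mulrA; congr (_ * _); rewrite mulrC.
Qed.

Lemma expi_trunc_le n t :
  nc (expi t - (exp_trunc R[i] n).[('i * rc t)%C]) <= 2 * `|t| ^+ n.+1.
Proof.
rewrite exp_trunc_ReIm; have [le_cos le_sin] := trig_trunc_le n.+1 t.
apply: le_trans (nc_ReIm _ _) _; rewrite mulr_natl mulr2n.
exact: lerD.
Qed.

Lemma expi_sub1_le t : nc (expi t - 1) <= 2 * `|t|.
Proof.
have := expi_trunc_le 0 t; rewrite expr1; congr (nc (_ - _) <= _).
by rewrite horner_sum big_ord1 !hornerE fact0 invr1.
Qed.

Lemma expiD s t : expi (s + t) = expi s * expi t.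
Proof. by rewrite /expi sinD cosD; simpc; congr (_ +i* _)%C; ring. Qed.

Lemma expi0 : expi 0 = 1 :> R[i].
Proof. by rewrite /expi cos0 sin0. Qed.

Lemma expiNM t : expi (- t) * expi t = 1.
Proof. by rewrite -expiD addNr expi0. Qed.

Lemma nc_expi t : nc (expi t) = 1.
Proof. by rewrite /= cos2Dsin2 sqrtr1. Qed.

Lemma expi_lipschitz s t : nc (expi s - expi t) <= 2 * `|s - t|.
Proof.
have -> : expi s - expi t = (expi (s - t) - 1) * expi t.
  by rewrite mulrBl mul1r -expiD subrK.
by rewrite ncM nc_expi mulr1 expi_sub1_le.
Qed.

End ImaginaryExponential.

(** * Orders of vanishing and bi-Lipschitz bounds *)

Section Asymptotics.
Variable R : realType.
Implicit Types (t theta : R) (f : R -> R).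

Local Notation nc := (@ComplexField.Normc.normc R).
Local Notation rc := (real_complex R).

Lemma near_dist_lt t e : 0 < e -> \forall s \near t, `|t - s| < e.
Proof. by move=> e0; apply/nbhs_ballP; exists e. Qed.

Lemma near0_lt e : 0 < e -> \forall s \near (0 : R), `|s| < e.
Proof.
by move/(near_dist_lt 0); apply: filterS => s; rewrite sub0r normrN.
Qed.

(** The error and F are compared only through this: each is shown to have the same exact order at
    0. *)
Definition order_at0 n f := exists a b : R, [/\ 0 < a, 0 < b &
  \forall theta \near (0 : R), a * `|theta| ^+ n <= f theta <= b * `|theta| ^+ n].

Lemma order_at0_comparable n f g : order_at0 n f -> order_at0 n g ->
  exists C1 C2 : R, [/\ 0 < C1, 0 < C2 &
    \forall theta \near (0 : R), C1 * g theta <= f theta <= C2 * g theta].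
Proof.
move=> [a [b [a0 b0 f_n]]] [a' [b' [a'0 b'0 g_n]]].
exists (a / b'), (b / a'); split; rewrite ?divr_gt0 //.
near=> t; have /andP[fa fb] : a * `|t| ^+ n <= f t <= b * `|t| ^+ n by near: t.
have /andP[ga gb] : a' * `|t| ^+ n <= g t <= b' * `|t| ^+ n by near: t.
apply/andP; split.
  by apply: le_trans fa; rewrite mulrAC ler_pdivrMr // -mulrA ler_pM2l // mulrC.
by apply: le_trans fb _; rewrite mulrAC ler_pdivlMr // -mulrA ler_pM2l // mulrC.
Unshelve. all: by end_near. Qed.

(** Near 0 the remainder of order n + 1 is at most half of the leading term. *)
Lemma order_at0_nc n (z : R -> R[i]) (a : R[i]) (M : R) : a != 0 ->
  (\forall theta \near (0 : R),
     nc (z theta - a * rc theta ^+ n) <= M * `|theta| ^+ n.+1) ->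
  order_at0 n (nc \o z).
Proof.
move=> a0 z_le; have a_gt0 : 0 < nc a by rewrite nc_gt0.
exists (nc a / 2), (nc a * 2); split; rewrite ?divr_gt0 ?mulr_gt0 //.
(* Dividing by |M| + 1 avoids any sign condition on M. *)
have M1 : 0 < `|M| + 1 by rewrite ltr_wpDl.
near=> t.
have zt : nc (z t - a * rc t ^+ n) <= nc a / 2 * `|t| ^+ n.
  have /le_trans : nc (z t - a * rc t ^+ n) <= M * `|t| ^+ n.+1 by near: t.
  apply; rewrite exprS mulrA ler_wpM2r ?exprn_ge0 //.
  have : `|t| < nc a / 2 / (`|M| + 1).
    by near: t; apply: near0_lt; rewrite !divr_gt0.
  rewrite ltr_pdivlMr // => /ltW; apply: le_trans.
  apply: le_trans (_ : `|M| * `|t| <= _); first by rewrite ler_wpM2r ?ler_norm.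
  by rewrite mulrC ler_wpM2l // lerDl.
have at_ : nc (a * rc t ^+ n) = nc a * `|t| ^+ n by rewrite ncM ncX nc_real.
rewrite /comp -[z t](subrK (a * rc t ^+ n)).
have := ncD (z t - a * rc t ^+ n) (a * rc t ^+ n).
have := nc_lower (a * rc t ^+ n) (z t - a * rc t ^+ n).
rewrite [a * _ + _]addrC at_.
have := mulr_ge0 (ltW a_gt0) (exprn_ge0 n (normr_ge0 t)).
move: (nc _) (nc (_ - _)) zt; move: (`|t| ^+ n) => u x y; lra.
Unshelve. all: by end_near. Qed.

(** The linear part g'(0) (x - y) dominates: the rest of h(x) - h(y) is at most half of it for small
    x, y and theta. *)
Lemma local_bilipschitz (g P : {poly R[i]}) : g.[0] = 0 -> g`_1 != 0 ->
  exists d k K : R, [/\ 0 < d, d <= 1, 0 < k, 0 < K &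
    forall theta x y, `|theta| <= d -> nc x <= d -> nc y <= d ->
    let h := g + (expi (- theta) - 1) *: P in
    k * nc (x - y) <= nc (h.[x] - h.[y]) <= K * nc (x - y)].
Proof.
move=> g0 g1; pose a := g`_1.
have a_gt0 : 0 < nc a by rewrite nc_gt0.
have [S gE] : exists S : {poly R[i]}, forall x, g.[x] = x ^+ 1 * (a + x * S.[x]).
  by apply: poly_order => -[|//] _; rewrite -horner_coef0.
pose H := 'X * S.
have [KH KH0 lipH] := poly_lipschitz H.
have [KP KP0 lipP] := poly_lipschitz P.
(* 2 KH comes from splitting x H(x) - y H(y) into two terms, 2 KP from |e^(-i theta) - 1| <= 2
   |theta|; the 1 keeps M positive. *)
pose M := 2 * KH + 2 * KP + 1; have M0 : 0 < M by rewrite /M; lra.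
pose d := Num.min 1 (nc a / 2 / M).
have d0 : 0 < d by rewrite lt_min ltr01 !divr_gt0.
have d1 : d <= 1 by rewrite ge_min lexx.
have dM : M * d <= nc a / 2 by rewrite mulrC -ler_pdivlMr // ge_min lexx orbT.
exists d, (nc a / 2), (2 * nc a); split; rewrite ?divr_gt0 ?mulr_gt0 //.
move=> theta x y td xd yd /=.
set r := x * H.[x] - y * H.[y] + (expi (- theta) - 1) * (P.[x] - P.[y]).
have -> : (g + (expi (- theta) - 1) *: P).[x] - (g + (expi (- theta) - 1) *:
  P).[y] =
    a * (x - y) + r by rewrite !hornerD !hornerZ !gE /r /H !hornerM !hornerX; ring.
have x1 := le_trans xd d1; have y1 := le_trans yd d1.
have Hx : nc H.[x] <= KH * d.
  have := lipH x 0 x1; rewrite nc0 => /(_ ler01).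
  rewrite hornerM hornerX hornerM hornerX mul0r !subr0 => /le_trans; apply.
  by rewrite ler_wpM2l.
have r_le : nc r <= nc a / 2 * nc (x - y).
  apply: le_trans (_ : M * d * nc (x - y) <= _); last by rewrite ler_wpM2r ?nc_ge0.
  have -> : r = (x - y) * H.[x] + y * (H.[x] - H.[y]) +
      (expi (- theta) - 1) * (P.[x] - P.[y]) by rewrite /r; ring.
  apply: le_trans (ncD _ _) _; apply: le_trans (lerD (ncD _ _) (lexx _)) _.
  rewrite !ncM.
  have e1 : nc (x - y) * nc H.[x] <= nc (x - y) * (KH * d) by rewrite ler_wpM2l
    ?nc_ge0.
  have e2 : nc y * nc (H.[x] - H.[y]) <= d * (KH * nc (x - y)).
    by rewrite ler_pM ?nc_ge0 ?lipH.
  have e3 : nc (expi (- theta) - 1) * nc (P.[x] - P.[y]) <=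
    (2 * d) * (KP * nc (x - y)).
    rewrite ler_pM ?nc_ge0 ?lipP //; apply: le_trans (expi_sub1_le _) _.
    by rewrite normrN ler_wpM2l.
  have := mulr_ge0 (ltW d0) (nc_ge0 (x - y)); rewrite /M; lra.
have := ncD (a * (x - y)) r; have := nc_lower (a * (x - y)) r; rewrite ncM.
have := mulr_ge0 (ltW a_gt0) (nc_ge0 (x - y)); lra.
Qed.

Lemma lipschitz_continuous (w : R -> R[i]^o) theta e M : `|theta| < e ->
  (forall t, `|t| < e -> nc (w theta - w t) <= M * `|theta - t|) ->
  {for theta, continuous w}.
Proof.
move=> te lipw; apply/(@cvgrPdist_lt _ R[i]^o) => eps eps0.
(* In the order of R[i] a positive element is real. *)
have -> : eps = rc (complex.Re eps) by apply/esym/RRe_real/gtr0_real.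
have e0 : 0 < complex.Re eps by move: eps0; rewrite ltcE => /andP[].
have M1 : 0 < `|M| + 1 by rewrite ltr_wpDl.
near=> t; rewrite [X in X < _](_ : _ = rc (nc (w theta - w t))) // ltcR.
have t_e : `|t| < e.
  have : `|theta - t| < e - `|theta| by near: t; apply: near_dist_lt;
    rewrite subr_gt0.
  by have := ler_normB theta (theta - t); rewrite opprB addrC subrK; lra.
apply: le_lt_trans (lipw t t_e) _.
apply: le_lt_trans (_ : (`|M| + 1) * `|theta - t| < _).
  by rewrite ler_wpM2r // (le_trans (ler_norm M)) // lerDl.
rewrite mulrC -ltr_pdivlMr //; near: t; apply: near_dist_lt.
by rewrite divr_gt0.
Unshelve. all: by end_near. Qed.

Lemma continuous_small (w : R -> R[i]^o) e : {for 0, continuous w} -> w 0 = 0 ->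
  0 < e -> \forall theta \near (0 : R), nc (w theta) <= e.
Proof.
move=> /(@cvgrPdist_lt _ R[i]^o) cw w0 e0; have := cw (rc e); rewrite ltcR =>
  /(_ e0).
apply: filterS => t; rewrite w0 sub0r normrN [X in X < _](_ : _ = rc (nc (w t))) //.
by rewrite ltcR => /ltW.
Qed.

End Asymptotics.

Lemma symb_poly_def (F : numFieldType) (p : nat) (L : {poly F}) x :
  symb p L x = \poly_(i < p.+1) L^`(p - i).[x].
Proof.
rewrite /symb poly_def [LHS](reindex_inj rev_ord_inj); apply: eq_bigr => i _ /=.
by rewrite subSS subKn // -ltnS.
Qed.

(** * The physical branch *)

Section PhysicalBranch.
Variables (R : realType) (p : nat) (chi : (p.+1).-tuple {poly_p.+1 R}).
Hypothesis chi_basis : basis_of fullv chi.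
Variable c : R.
Hypothesis c_gt : c_minus R p < c.
Implicit Types (w : R -> R[i]^o).

Local Notation nc := (@ComplexField.Normc.normc R).
Local Notation rc := (real_complex R).
Local Notation L := (lift_poly chi c).
Local Notation LC := (lift_polyC chi c).
Local Notation g := (char_esfr chi c).

Lemma size_lift_polyC : (size LC <= p.+1)%N.
Proof. by rewrite size_map_poly size_lift_poly. Qed.

Lemma lift_polyC_top : LC`_p *+ p`! != 0.
Proof. by rewrite coef_map -rmorphMn fmorph_eq0; exact: lift_top_neq0. Qed.

Lemma char_esfr_shift theta : g theta = g 0 + (expi (- theta) - 1) *: symb p LC 1.
Proof.
rewrite /char_esfr oppr0 expi0 scale1r scalerBl scale1r -[RHS]addrA.
by congr (_ + _); rewrite addrCA subrr addr0.
Qed.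

Lemma size_symb (F : numFieldType) (q : {poly F}) x : (size (symb p q x) <= p.+1)%N.
Proof. by rewrite symb_poly_def size_poly. Qed.

Lemma char_esfr_monic theta : g theta \is monic /\ size (g theta) = p.+2.
Proof.
pose r := - symb p LC (-1) + expi (- theta) *: symb p LC 1.
have gE : g theta = 'X^(p.+1) + r by rewrite /char_esfr addrA.
have lt_r : (size r < size ('X^(p.+1) : {poly R[i]}))%N.
  rewrite size_polyXn ltnS; apply: leq_trans (size_polyD _ _) _.
  by rewrite geq_max size_polyN size_symb (leq_trans (size_scale_leq _ _))
    ?size_symb.
by rewrite gE monicE lead_coefDl // lead_coefXn eqxx size_polyDl // size_polyXn.
Qed.

(** The constant coefficients of P and Q are both the value of the constant L^(p), so they cancel at
    theta = 0. *)
Lemma char_esfr0_root : (g 0).[0] = 0.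
Proof.
rewrite horner_coef0 /char_esfr oppr0 expi0 scale1r coefD coefB coefXn sub0r.
rewrite !symb_poly_def !coef_poly subn0 derivn_top ?size_lift_polyC //.
by rewrite !hornerC addNr.
Qed.

(** For p > 0 this coefficient is L^(p-1)(1) - L^(p-1)(-1), the integral of the nonzero constant
    L^(p); for p = 0 it is the leading coefficient 1. *)
Lemma char_esfr0_simple : (g 0)`_1 != 0.
Proof.
rewrite /char_esfr oppr0 expi0 scale1r coefD coefB coefXn !symb_poly_def !coef_poly.
have := size_lift_polyC; have := lift_polyC_top.
move: LC => l; case: (p) => [|q]; first by rewrite subr0 addr0 oner_neq0.
move=> top sz /=; rewrite sub0r addrC subn1 /= -intp_deriv -derivnS derivn_top //.
rewrite -[_%:P]mulr1 mul_polyC intpZ mulf_neq0 //.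
have := intp_deriv ('X : {poly R[i]}); rewrite derivX !hornerX opprK => ->.
by rewrite -[_ + _]/(2%:R) pnatr_eq0.
Qed.

Lemma char_esfr_small_root : exists d e k K B : R,
  [/\ 0 < d, d <= 1, 0 < e & e <= d] /\ [/\ 0 < k, 0 < K &
  (forall theta, `|theta| <= e -> exists2 z, root (g theta) z & nc z <= d)] /\
  (forall theta x y, `|theta| <= e -> nc x <= d -> nc y <= d ->
    k * nc (x - y) <= nc ((g theta).[x] - (g theta).[y]) <= K * nc (x - y)) /\
  (forall theta t x, nc x <= d ->
    nc ((g theta).[x] - (g t).[x]) <= B * `|theta - t|).
Proof.
have [d [k [K [d0 d1 k0 K0 lip]]]] :=
  local_bilipschitz (symb p LC 1) char_esfr0_root char_esfr0_simple.
have [B B0 leB] := poly_bounded (symb p LC 1).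
(* The value of the polynomial at 0 has modulus at most 2 e B; this e brings it below d^(p+1), as
   [monic_small_root] asks. *)
pose e := Num.min d (d ^+ p.+1 / (2 * B + 1)).
have B1 : 0 < 2 * B + 1 by lra.
have e_d : e <= d by rewrite ge_min lexx.
have e_B : (2 * B + 1) * e <= d ^+ p.+1 by rewrite mulrC -ler_pdivlMr // ge_min
  lexx orbT.
have e0 : 0 < e by rewrite lt_min d0 divr_gt0 ?exprn_gt0.
exists d, e, k, K, (2 * B); split=> //; split; [split=> //|split].
- move=> theta te; have [g_monic g_size] := char_esfr_monic theta.
  apply: monic_small_root g_size _ => //.
  rewrite char_esfr_shift hornerD char_esfr0_root add0r hornerZ ncM.
  apply: le_trans e_B; apply: le_trans (_ : (2 * e) * B <= _); last by lra.
  rewrite ler_pM ?nc_ge0 // ?leB ?nc0 //.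
  by apply: le_trans (expi_sub1_le _) _; rewrite normrN ler_wpM2l.
- move=> theta x y te xd yd; rewrite char_esfr_shift; apply: lip => //.
  exact: le_trans te e_d.
move=> theta t x xd; rewrite (char_esfr_shift theta) (char_esfr_shift t).
move: (g 0) => g0; rewrite !hornerD !hornerZ.
have -> : g0.[x] + (expi (- theta) - 1) * (symb p LC 1).[x] -
    (g0.[x] + (expi (- t) - 1) * (symb p LC 1).[x]) =
    (expi (- theta) - expi (- t)) * (symb p LC 1).[x] by ring.
rewrite ncM [2 * B * _]mulrAC; rewrite ler_pM ?nc_ge0 ?leB // ?(le_trans xd) //.
by apply: le_trans (expi_lipschitz _ _) _; rewrite opprK addrC distrC.
Qed.

Local Notation m2i := (- (2 * 'i%C) : R[i]).

Lemma m2i_neq0 : m2i != 0.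
Proof. by rewrite -nc_eq0 ncN ncM nc_i -(rmorph_nat rc) nc_real mulr1 normr_eq0
  pnatr_eq0. Qed.

Lemma nc_m2i : nc m2i = 2.
Proof. by rewrite ncN ncM nc_i -(rmorph_nat rc) nc_real mulr1 normr_nat. Qed.

(** Continuity at 0 confines any branch to a prescribed disc, in particular to one where the
    bi-Lipschitz bounds hold. *)
Lemma eigen_branch_near w d : 0 < d -> eigen_branch c chi w ->
  \forall theta \near (0 : R), root (g theta) (w theta / m2i) /\
    nc (w theta / m2i) <= d.
Proof.
move=> d0 [w0 near_w]; have [cw _] := nbhs_singleton near_w.
have d2 : 0 < 2 * d by lra.
apply: filterS2 near_w (continuous_small cw w0 d2) => theta [_ eig] wd.
rewrite -(eigenvalue_esfr chi_basis c_gt) mulrC divfK ?m2i_neq0 //; split=> //.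
by rewrite ncM ComplexField.Normc.normcV nc_m2i ler_pdivrMr // mulrC.
Qed.

(** The lower Lipschitz bound leaves room for one root only in the disc. *)
Lemma eigen_branch_unique w w' : eigen_branch c chi w -> eigen_branch c chi w' ->
  \forall theta \near (0 : R), w' theta = w theta.
Proof.
have [d [e [k [K [B [[d0 d1 e0 ed] [[k0 K0 ex] [lip _]]]]]]]] :=
  char_esfr_small_root.
move=> /(eigen_branch_near d0) near_w /(eigen_branch_near d0) near_w'.
near=> theta.
have [rw sw] : root (g theta) (w theta / m2i) /\ nc (w theta / m2i) <= d by near:
  theta.
have [rw' sw'] : root (g theta) (w' theta / m2i) /\ nc (w' theta / m2i) <=
  d by near: theta.
have te : `|theta| <= e by apply/ltW; near: theta; exact: near0_lt.
have /andP[le_k _] := lip theta _ _ te sw' sw.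
move: le_k; rewrite (rootP rw) (rootP rw') subrr nc0 pmulr_rle0 // => le0.
have : nc (w' theta / m2i - w theta / m2i) == 0 by rewrite eq_le le0 nc_ge0.
by rewrite nc_eq0 subr_eq0 => /eqP /(mulIf (invr_neq0 m2i_neq0)).
Unshelve. all: by end_near. Qed.

(** A root is chosen in the disc for each theta. The lower bound in mu and the Lipschitz bound in
    theta make the choice Lipschitz with constant B / k, and force it to be 0 at theta = 0. *)
Lemma eigen_branch_exists : exists w, eigen_branch c chi w.
Proof.
have [d [e [k [K [B [[d0 d1 e0 ed] [[k0 K0 ex] [lip lipB]]]]]]]] :=
  char_esfr_small_root.
pose mu theta := xget 0 [set z | root (g theta) z /\ nc z <= d].
have muP theta : `|theta| <= e -> root (g theta) (mu theta) /\ nc (mu theta) <= d.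
  by move=> /ex[z rz zd]; rewrite /mu; case: xgetP => [? _ //|/(_ z)[]].
have mu_lip theta t : `|theta| <= e -> `|t| <= e ->
    nc (mu theta - mu t) <= B / k * `|theta - t|.
  move=> te tt; have [r1 s1] := muP _ te; have [r2 s2] := muP _ tt.
  have /andP[le_k _] := lip theta _ _ te s1 s2.
  rewrite mulrAC ler_pdivlMr // mulrC; apply: le_trans le_k _.
  rewrite (rootP r1) -(rootP r2) ncBC; exact: lipB.
exists (fun theta => m2i * mu theta); split.
  have z0 : `|0 : R| <= e by rewrite normr0 ltW.
  have [r1 s1] := muP 0 z0; have z_d : nc 0 <= d by rewrite nc0 ltW.
  have /andP[le_k _] := lip 0 _ _ z0 s1 z_d.
  move: le_k; rewrite (rootP r1) char_esfr0_root subrr nc0 pmulr_rle0 // subr0 =>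
    le0.
  have : nc (mu 0) == 0 by rewrite eq_le le0 nc_ge0.
  by rewrite nc_eq0 => /eqP ->; rewrite mulr0.
near=> theta.
have te : `|theta| < e by near: theta; exact: near0_lt.
split; last by rewrite eigenvalue_esfr //; have [] := muP _ (ltW te).
apply: (@lipschitz_continuous _ _ _ e (2 * (B / k))) => // t t_e.
by rewrite -mulrBr ncM nc_m2i -mulrA ler_wpM2l // mu_lip ?ltW.
Unshelve. all: by end_near. Qed.

End PhysicalBranch.

Lemma defect_map (F K : numFieldType) (f : {rmorphism F -> K}) (L : {poly F}) j :
  defect (map_poly f L) j = f (defect L j).
Proof.
rewrite /defect rmorphB rmorphXn rmorphN rmorph_nat -intp_map; congr (_ - intp _).
by rewrite rmorphM rmorphXn rmorphB /= map_polyX rmorph1.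
Qed.

(** * Exact order of the dispersion-dissipation error *)

Section ErrorOrder.
Variables (R : realType) (p : nat) (chi : (p.+1).-tuple {poly_p.+1 R}).
Hypothesis chi_basis : basis_of fullv chi.
Variable c : R.
Hypothesis c_gt : c_minus R p < c.

Local Notation nc := (@ComplexField.Normc.normc R).
Local Notation rc := (real_complex R).
Local Notation L := (lift_poly chi c).
Local Notation LC := (lift_polyC chi c).
Local Notation g := (char_esfr chi c).
Local Notation m2i := (- (2 * 'i%C) : R[i]).

(** The value of mu = i omega / 2 for the exact omega = theta. *)
Definition half_i (theta : R) : R[i] := 'i%C * rc theta / 2.

Lemma nc_half_i theta : nc (half_i theta) = `|theta| / 2.
Proof.
by rewrite !ncM nc_i mul1r nc_real ComplexField.Normc.normcV -(rmorph_nat rc)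
  nc_real normr_nat.
Qed.

(** Multiplication by e^(i theta), of modulus one, produces the residual P - e^(2 mu) (Q -
    mu^(p+1)); replacing e^(i theta) by [exp_trunc] costs O(|theta|^(n+1)). *)
Lemma char_esfr_half_i_order m : (forall j, (j < m)%N -> defect L j = 0) ->
  defect L m != 0 ->
  order_at0 (p.+1 + m) (fun theta => nc (g theta).[half_i theta]).
Proof.
move=> def_lt def_m; set n := (p.+1 + m)%N.
have defC j : defect LC j = rc (defect L j) by exact: defect_map.
have [S SE] : exists S : {poly R[i]}, forall mu,
    (symb p LC 1).[mu] - (exp_trunc R[i] n).[2 * mu] *
      ((symb p LC (-1)).[mu] - mu ^+ p.+1) =
    mu ^+ n * ((-1) ^+ m / m`!%:R * defect LC m + mu * S.[mu]).
  apply: residual_leading; first exact: size_lift_polyC.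
  by move=> j lt_jm; rewrite defC def_lt // rmorph0.
pose a0 := (-1) ^+ m / m`!%:R * defect LC m.
pose Q := symb p LC (-1) - 'X^(p.+1).
have [BS BS0 leS] := poly_bounded S; have [BQ BQ0 leQ] := poly_bounded Q.
pose z theta := expi theta * (g theta).[half_i theta].
have zE theta : z theta = (symb p LC 1).[half_i theta] - expi theta * Q.[half_i
  theta].
  rewrite /z /char_esfr /Q !(hornerD, hornerN, hornerZ, hornerXn).
  by rewrite -[X in _ = X - _]mul1r -(expiNM theta); ring.
have -> : (fun theta => nc (g theta).[half_i theta]) = nc \o z.
  by apply/funext => theta; rewrite /= ncM nc_expi mul1r.
apply: (@order_at0_nc _ _ _ (a0 * ('i%C / 2) ^+ n) (BS + 2 * BQ)).
  have fm : m`!%:R != 0 :> R[i] by rewrite pnatr_eq0 -lt0n fact_gt0.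
  have i2 : 'i%C / 2 != 0 :> R[i].
    by rewrite mulf_neq0 ?invr_eq0 ?pnatr_eq0 // -nc_eq0 nc_i oner_eq0.
  rewrite mulf_neq0 ?expf_neq0 // /a0 mulf_neq0 ?defC ?fmorph_eq0 //.
  by rewrite mulf_neq0 ?signr_eq0 ?invr_eq0.
near=> t.
have t1 : `|t| <= 1 by apply/ltW; near: t; exact: near0_lt.
have h1 : nc (half_i t) <= 1 by rewrite nc_half_i; lra.
have two_h : 2 * half_i t = 'i%C * rc t by rewrite /half_i mulrC divfK ?pnatr_eq0.
have -> : z t - a0 * ('i%C / 2) ^+ n * rc t ^+ n =
    half_i t ^+ n * half_i t * S.[half_i t]
    - (expi t - (exp_trunc R[i] n).['i%C * rc t]) * Q.[half_i t].
  have := SE (half_i t); rewrite -/a0 two_h zE.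
  have -> : (symb p LC (-1)).[half_i t] - half_i t ^+ p.+1 = Q.[half_i t].
    by rewrite !(hornerD, hornerN, hornerXn).
  have -> : a0 * ('i%C / 2) ^+ n * rc t ^+ n = half_i t ^+ n * a0.
    by rewrite -mulrA -exprMn mulrC [_ / 2 * _]mulrAC.
  move: (symb _ _ _).[_] (exp_trunc _ _).[_] Q.[_] S.[_] => s e q u.
  by move: (half_i t ^+ n) => v /eqP; rewrite subr_eq => /eqP ->; ring.
apply: le_trans (ncB _ _) _; rewrite -exprSr 2!ncM ncX nc_half_i mulrDl lerD //.
  have h0 : 0 <= `|t| / 2 by rewrite divr_ge0.
  have h2 : `|t| / 2 <= `|t| by have := normr_ge0 t; lra.
  by rewrite [BS * _]mulrC ler_pM ?nc_ge0 ?exprn_ge0 ?leS // lerXn2r.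
rewrite mulrAC ler_pM ?nc_ge0 ?leQ //; exact: expi_trunc_le.
Unshelve. all: by end_near. Qed.

(** Since w / (-2i) is a root, the bi-Lipschitz bounds make its distance to [half_i] comparable with
    the residual; |-2i| = 2 accounts for the factor 2. *)
Lemma E_T_order m w : (forall j, (j < m)%N -> defect L j = 0) ->
  defect L m != 0 -> eigen_branch c chi w -> order_at0 (p.+1 + m) (E_T w).
Proof.
move=> def_lt def_m branch.
have [d [e [k [K [B [[d0 d1 e0 ed] [[k0 K0 ex] [lip _]]]]]]]] :=
  char_esfr_small_root chi_basis c_gt.
have near_w := eigen_branch_near chi_basis c_gt d0 branch.
have [a [b [a0 b0 ord]]] := char_esfr_half_i_order def_lt def_m.
exists (2 * a / K), (2 * b / k); split; rewrite ?divr_gt0 ?mulr_gt0 //.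
near=> t.
have [rw sw] : root (g t) (w t / m2i) /\ nc (w t / m2i) <= d by near: t.
have te : `|t| < e by near: t; exact: near0_lt.
have hd : nc (half_i t) <= d by rewrite nc_half_i; have := normr_ge0 t; lra.
have /andP[ga gb] : a * `|t| ^+ (p.+1 + m) <= nc (g t).[half_i t] <=
  b * `|t| ^+ (p.+1 + m).
  by near: t.
have /andP[lk lK] := lip t _ _ (ltW te) hd sw.
rewrite (rootP rw) subr0 in lk lK.
have -> : E_T w t = 2 * nc (half_i t - w t / m2i).
  rewrite /E_T ncBC -[2 in RHS]nc_m2i -ncM mulrBr [m2i * (w t / _)]mulrC divfK
    ?m2i_neq0 //.
  congr (nc (_ - _)); rewrite /half_i.
  have -> : m2i * ('i%C * rc t / 2) = - ('i%C ^+ 2) * rc t by field.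
  by rewrite sqr_i opprK mul1r.
have := le_trans ga lK; have := le_trans lk gb.
move: (nc (_ - _)) (`|t| ^+ _) => x y lex ley; apply/andP; split.
  by rewrite mulrAC ler_pdivrMr // -!mulrA ler_pM2l // [x * K]mulrC.
by rewrite mulrAC ler_pdivlMr // -!mulrA ler_pM2l // [x * k]mulrC.
Unshelve. all: by end_near. Qed.

End ErrorOrder.

(** * Exact order of F *)

Section PredictedOrder.
Variables (R : realType) (p : nat) (c : R).
Local Notation nc := (@ComplexField.Normc.normc R).
Local Notation rc := (real_complex R).

Lemma expr_i_neq0 n : 'i%C ^+ n != 0 :> R[i].
Proof. by rewrite -nc_eq0 ncX nc_i expr1n oner_eq0. Qed.

Lemma fact_neq0 n : n`!%:R != 0 :> R.
Proof. by rewrite pnatr_eq0 -lt0n fact_gt0. Qed.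

(** f(c) = 1 would force c = 0, the factor of c in the denominator being nonzero. *)
Lemma b1_neq0 : c != 0 -> b1 p c != 0.
Proof.
move=> c0; rewrite /b1 !mulf_neq0 ?invr_eq0 ?fact_neq0 //.
rewrite subr_eq0 eq_sym; apply: contra_neq c0 => /(congr1 GRing.inv).
rewrite invrK invr1 => /eqP; rewrite -subr_eq0 addrAC subrr add0r mulf_eq0.
case/orP => [/eqP //|]; rewrite mulf_eq0 invr_eq0 !mulf_eq0 !expf_eq0 /=.
by rewrite !(negPf (fact_neq0 _)) !pnatr_eq0.
Qed.

Lemma F_esfr_order : order_at0 (p.+1 + (if c == 0 then p.+1 else p)) (F_esfr p c).
Proof.
pose z theta : R[i] := rc (b1 p c) * ('i%C * rc theta) ^+ (2 * p).+1 +
  rc (b2 p c) * ('i%C * rc theta) ^+ (2 * p).+2.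
have -> : F_esfr p c = nc \o z by [].
case: eqVneq => [c0|c_neq0].
  have -> : (p.+1 + p.+1 = (2 * p).+2)%N by lia.
  have f1 : f_esfr p c = 1 by rewrite /f_esfr c0 mul0r addr0 invr1.
  (* Here b1 = 0, so F is the modulus of a pure monomial and the remainder constant is 0. *)
  apply: (@order_at0_nc _ _ _ (rc (b2 p c) * 'i%C ^+ (2 * p).+2) 0).
    rewrite mulf_neq0 ?expr_i_neq0 // fmorph_eq0 /b2 f1 subrr !mul0r add0r.
    by rewrite mulf_neq0 ?invr_eq0 ?fact_neq0.
  have b10 : b1 p c = 0 by rewrite /b1 f1 subrr !mul0r.
  near=> t; rewrite /z b10 (rmorph0 rc) mul0r add0r exprMn mulrA subrr.
  by rewrite nc0 mul0r.
have -> : (p.+1 + p = (2 * p).+1)%N by lia.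
apply: (@order_at0_nc _ _ _ (rc (b1 p c) * 'i%C ^+ (2 * p).+1) `|b2 p c|).
  by rewrite mulf_neq0 ?expr_i_neq0 // fmorph_eq0 b1_neq0.
near=> t; rewrite /z exprMn mulrA addrAC subrr add0r.
by rewrite ncM ncX ncM nc_i mul1r !nc_real.
Unshelve. all: by end_near. Qed.

End PredictedOrder.

Theorem theorem3p5 (R : realType) (p : nat)
  (chi : (p.+1).-tuple {poly_p.+1 R}) (hchi : basis_of fullv chi)
  (c : R) (hc : c_minus R p < c) :
  (exists w : R -> R[i]^o, physical_eigenvalue c chi w) /\
  (forall w : R -> R[i]^o, physical_eigenvalue c chi w ->
    exists C1 C2 : R, [/\ 0 < C1, 0 < C2 &
      \forall theta \near (0 : R),
        C1 * F_esfr p c theta <= E_T w theta <= C2 * F_esfr p c theta]).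
Proof.
split.
  have [w branch] := eigen_branch_exists hchi hc; exists w; split=> // w' branch'.
  exact: eigen_branch_unique branch branch'.
move=> w [branch _].
have [m mE [def_lt def_m]] :=
  defect_order (size_lift_poly chi c) (lift_poly_repr hchi hc).
apply: order_at0_comparable (F_esfr_order p c).
by rewrite -mE; exact: E_T_order def_lt def_m branch.
Qed.
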